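(* If $G$ is a connected geometric graph in $\mathbb{R}^2$, then $c(G) \leq 9$.
   Context: Geometric graph: given points $x_1,\dots,x_n\in\mathbb{R}^2$ and $r>0$, the geometric graph $G(x_1,\dots,x_n;r)$ has vertex set $\{x_1,\dots,x_n\}$ (formally indices $1,\dots,n$), with $x_i,x_j$ ($i\neq j$) adjacent iff $\|x_i-x_j\|\le r$ (Euclidean norm). Game of cops and robbers on a finite graph $G$: first $\ell$ cops choose starting vertices, then one robber chooses a starting vertex; then the players alternate turns, where on its turn each agent moves to an adjacent vertex or stays put (all cops move simultaneously on the cops' turn; both sides have full information and the cops may coordinate). The cops win if after finitely many moves some cop occupies the robber's vertex. The cop number $c(G)$ is the minimum $\ell$ such that $\ell$ cops have a strategy that wins against every robber strategy. *)

(* Defs.v *)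
From Stdlib Require Import Reals.
From mathcomp Require Import all_boot.
Set Implicit Arguments. Unset Strict Implicit. Unset Printing Implicit Defensive.

Definition dist2 (p q : R * R) : R :=
  sqrt (Rplus (pow (Rminus (fst p) (fst q)) 2) (pow (Rminus (snd p) (snd q)) 2)).

Definition geom_adj (n : nat) (x : 'I_n -> R * R) (r : R) : rel 'I_n :=
  fun i j => (i != j) && (if Rle_dec (dist2 (x i) (x j)) r then true else false).

Definition connected_graph (V : finType) (e : rel V) : Prop :=
  forall u v : V, connect e u v.

Section Game.
Variables (V : finType) (e : rel V) (k : nat).

Definition step (u v : V) : bool := (u == v) || e u v.

Definition caught (c : 'I_k -> V) (r : V) : Prop := exists i, c i = r.

(* Positions from which the cops can force a capture in finitely many moves.
   robber_to_move c r : robber to move, cops at c, robber at r.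
   cops_to_move c r   : cops to move. *)
Inductive robber_to_move : ('I_k -> V) -> V -> Prop :=
| RCaught c r : caught c r -> robber_to_move c r
| RMove c r : (forall r', step r r' -> cops_to_move c r') -> robber_to_move c r
with cops_to_move : ('I_k -> V) -> V -> Prop :=
| CCaught c r : caught c r -> cops_to_move c r
| CMove c r c' : (forall i, step (c i) (c' i)) -> robber_to_move c' r ->
                 cops_to_move c r.

Definition cops_win : Prop :=
  exists c0 : 'I_k -> V, forall r0 : V, cops_to_move c0 r0.
End Game.

Definition cop_number_le (V : finType) (e : rel V) (m : nat) : Prop :=
  exists l, (l <= m)%N /\ cops_win e l.

(* Main.v *)
Require Import Defs.
From Stdlib Require Import Reals Lra Psatz ZArith.
From Stdlib Require ClassicalEpsilon.
From mathcomp Require Import all_boot.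
From mathcomp Require Import zify.
Set Implicit Arguments. Unset Strict Implicit. Unset Printing Implicit Defensive.

(* Cops move in groups of three.  Fix a root and a geodesic P = (P_0, ..., P_h) of the graph starting there.
   Once a group has positioned itself on the three vertices of P around the level of the robber (the distance
   to the root), which takes finitely many moves, the robber is caught as soon as he crosses P: if the edge cd
   of the robber crosses the edge ab of P, one of a, b, c, d is adjacent to the three others.  He is also caught
   if his edge passes through a point whose nearest vertex is P_h, since then P_h is adjacent to both ends.

   Two guarded geodesics ending at the nearest vertices of two close points y, y' of the plane thus give a
   guarded closed curve.  If the robber is inside (with respect to winding numbers mod 2) and a third group
   guards a geodesic ending near a third close point, the robber is inside one of the two new curves, and one of
   the first two groups is free again.  Hence, when the nodes of a fine grid are labelled by such geodesics, the
   grid edges whose closed curve is a trap leading to capture are closed under completing unit squares; if they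
   contain a spanning tree, they are all the edges, because the dual of the complement of a spanning tree is a
   tree.  The cops win by adding up the edges of the boundary of the grid, which encloses the robber.

   It remains to label the nodes so that the edges whose curve has no uncaught vertex inside connect all nodes.
   From every vertex, walk straight to the nearest vertex of the previous level, and from other nodes straight
   to the nearest vertex, stopping at the first node already labelled; the labels are then propagated backwards
   along the walk.  The inequalities hold up to multiples of the mesh, which is harmless as there are finitely
   many distances between vertices: this is the role of [gap]. *)

(** * The game and guarded geodesics *)

Section Levels.
Variables (V : finType) (e : rel V) (o : V).
Hypothesis conn : forall v, connect e o v.

Lemma ex_path_size v : exists m, [exists p : m.-tuple V, path e o p && (last o p == v)].
Proof.
have /connectP[p pp ->] := conn v; exists (size p); apply/existsP; exists (in_tuple p).
by rewrite pp /=.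
Qed.

Definition lev v := ex_minn (ex_path_size v).

Lemma lev_root : lev o = 0.
Proof.
rewrite /lev; case: ex_minnP => m _ /(_ 0) H; apply/eqP; rewrite -leqn0; apply: H.
by apply/existsP; exists [tuple]; rewrite /=.
Qed.

Lemma lev_eq0 v : lev v = 0 -> v = o.
Proof.
rewrite /lev; case: ex_minnP => m /existsP[p /andP[_ /eqP <-]] _ m0.
by case: m p m0 => // p _; rewrite (tuple0 p).
Qed.

Lemma lev_edge u v : e u v -> lev v <= (lev u).+1.
Proof.
rewrite /lev => uv; case: (ex_minnP (ex_path_size v)) => m _; apply.
case: ex_minnP => k /existsP[p /andP[pp /eqP lp]] _.
apply/existsP; exists [tuple of rcons p v].
by rewrite /= rcons_path pp lp uv last_rcons eqxx.
Qed.

Lemma lev_parent v m : lev v = m.+1 -> exists2 u, lev u = m & e u v.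
Proof.
move=> lv; have := lv; rewrite {1}/lev; case: ex_minnP => k /existsP[p /andP[pp /eqP lp]] _ km.
subst k; case/lastP: (tval p) (size_tuple p) pp lp => // q w.
rewrite size_rcons rcons_path last_rcons => -[sq] /andP[pq ew] wv; subst w.
exists (last o q) => //; apply/eqP; rewrite eqn_leq; apply/andP; split; last first.
  by have := lev_edge ew; rewrite lv ltnS.
rewrite {1}/lev; case: ex_minnP => k _; apply; apply/existsP; rewrite -sq.
by exists (in_tuple q); rewrite pq /=.
Qed.
End Levels.

(** * Groups of three cops tracking a geodesic *)

Section Guarding.
Variables (V : finType) (e : rel V) (o : V).
Hypothesis esym : symmetric e.
Hypothesis conn : forall v, connect e o v.
Local Notation lev := (lev conn).
Local Notation step := (step e).

Lemma step_refl v : step v v. Proof. by rewrite /Defs.step eqxx. Qed.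
Lemma step_sym u v : step u v = step v u.
Proof. by rewrite /Defs.step eq_sym esym. Qed.

Lemma lev_step u v : step u v -> lev v <= (lev u).+1.
Proof. by case/orP=> [/eqP <-|]; [exact: leqnSn|exact: lev_edge]. Qed.

Definition geodesic (P : seq V) :=
  [/\ 0 < size P,
      forall i, i < size P -> lev (nth o P i) = i
    & forall i, i.+1 < size P -> step (nth o P i) (nth o P i.+1)].

(* The k-th cop (k < 3) of a group guarding P tracks the level of the robber, shifted by k - 1 and
   truncated to the length of P. *)
Definition track (P : seq V) (x : V) (k : nat) := nth o P (minn (lev x + k).-1 (size P).-1).

Definition legal P x := ~~ step (track P x 1) x.
(** This describes the moment between the two halves of a round: the robber stands on [x'], while
    the cops are still placed for his previous vertex [x]. *)
Definition safe P x x' := forall k, k < 3 -> ~~ step (track P x k) x'.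

Lemma geodesic_step P i j : geodesic P -> i < size P -> j < size P ->
  i <= j.+1 -> j <= i.+1 -> step (nth o P i) (nth o P j).
Proof.
move=> [_ _ st] iP jP; rewrite leq_eqVlt => /orP[/eqP ij _|].
  by subst i; rewrite step_sym st.
rewrite ltnS leq_eqVlt => /orP[/eqP -> _|ij]; first exact: step_refl.
by rewrite leq_eqVlt ltnS => /orP[/eqP ji|]; [subst j; exact: st|rewrite leqNgt ij].
Qed.

Lemma geodesic_nil : geodesic [:: o].
Proof. by split=> // -[|i] // _; rewrite /= lev_root. Qed.

Lemma trackP P x k : geodesic P -> minn (lev x + k).-1 (size P).-1 < size P.
Proof. by case=> P0 _ _; rewrite -[X in _ < X](prednK P0) ltnS geq_minr. Qed.

Lemma track_step P x x' k : geodesic P -> step x x' -> step (track P x k) (track P x' k).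
Proof.
move=> gP xx'; have h1 := lev_step xx'; rewrite step_sym in xx'; have h2 := lev_step xx'.
apply: geodesic_step => //; try exact: trackP.
all: by move: h1 h2; clear; move: (lev x) (lev x') (size P).-1 => a b h; lia.
Qed.
(** The level changes by at most one in a step, so the vertex that the middle cop has to take for
    [x'] is already occupied by one of the three cops placed for [x]. *)
Lemma safe_legal P x x' : step x x' -> safe P x x' -> legal P x'.
Proof.
move=> xx' sf; have h1 := lev_step xx'; rewrite step_sym in xx'; have h2 := lev_step xx'.
have lt3 : (lev x').+1 - lev x < 3 by lia.
have := sf _ lt3; rewrite /legal /track.
by have -> : (lev x + ((lev x').+1 - lev x)).-1 = (lev x' + 1).-1 by lia.
Qed.

(** A vertex of [P] within a step of [x] has a level within one of that of [x], so one of the three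
    cops stands on it. *)
Lemma safe_near P x x' i : geodesic P -> i < size P -> safe P x x' ->
  step (nth o P i) x -> ~~ step (nth o P i) x'.
Proof.
move=> [P0 Pl _] iP sf; move=> st; have h1 := lev_step st; rewrite step_sym in st.
have := lev_step st; rewrite Pl // in h1 * => h2.
have lt3 : i.+1 - lev x < 3 by lia.
have := sf _ lt3; rewrite /track.
by have -> : minn (lev x + (i.+1 - lev x)).-1 (size P).-1 = i by lia.
Qed.

(** Such an [x] would have level [i] or [i.+1], which puts the middle cop on one of the two
    vertices. *)
Lemma legal_consecutive P x i : geodesic P -> i.+1 < size P -> legal P x ->
  ~~ (step (nth o P i) x && step (nth o P i.+1) x).
Proof.
move=> [P0 Pl _] iP; apply: contra => /andP[st1 st2].
have h1 := lev_step st1; have h2 := lev_step st2.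
have st1' := st1; rewrite step_sym in st1'; have h3 := lev_step st1'.
have st2' := st2; rewrite step_sym in st2'; have h4 := lev_step st2'.
rewrite !Pl in h1 h2 h3 h4; try lia.
rewrite /track; have : lev x = i \/ lev x = i.+1 by lia.
case=> ->; first by have -> : minn (i + 1).-1 (size P).-1 = i by lia.
by have -> : minn (i.+1 + 1).-1 (size P).-1 = i.+1 by lia.
Qed.

Lemma legal_rcons Q v x : geodesic (rcons Q v) -> legal (rcons Q v) x -> step v x ->
  (0 < size Q -> step (last o Q) x) -> False.
Proof.
move=> gP lg sv; case: (ltnP 0 (size Q)) => [Q0 /(_ isT) sl|Q0 _].
- have sP : (size Q).-1.+1 < size (rcons Q v) by rewrite size_rcons; lia.
  have := legal_consecutive gP sP lg; rewrite !nth_rcons (prednK Q0) ltnn eqxx.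
  by rewrite leqnn nth_last sl sv.
- by move: lg; rewrite /legal /track size_rcons; case: (Q) Q0 => //= _; rewrite sv.
Qed.

Local Notation cfg F := (fun i : 'I_9 => F (i %/ 3) (i %% 3)).
Definition robber_loses (F : nat -> nat -> V) x := robber_to_move e (cfg F) x.

(** A robber who stops within reach of a cop is caught at once, so the cops only need an answer to
    his other moves. *)
Lemma robber_round (F : nat -> nat -> V) x :
  (forall x', step x x' -> (forall s k, s < 3 -> k < 3 -> ~~ step (F s k) x') ->
     exists2 F' : nat -> nat -> V,
       (forall s k, s < 3 -> k < 3 -> step (F s k) (F' s k)) & robber_loses F' x') ->
  robber_loses F x.
Proof.
move=> H; apply: RMove => x' xx'.
have bnd (i : 'I_9) : (i %/ 3 < 3) && (i %% 3 < 3).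
  by have := ltn_ord i; lia.
case: (pickP (fun i : 'I_9 => step (F (i %/ 3) (i %% 3)) x')) => [i si|none].
- apply: (@CMove _ _ _ _ _
    (fun j : 'I_9 => if step (F (j %/ 3) (j %% 3)) x' then x' else F (j %/ 3) (j %% 3))).
    by move=> j; case: ifP => // _; exact: step_refl.
  by apply: RCaught; exists i; rewrite si.
- have [s k s3 k3|F' FF' RF'] := H x' xx'.
    have lt9 : s * 3 + k < 9 by lia.
    have := none (Ordinal lt9); rewrite /= divnMDl // divn_small // addn0.
    by rewrite modnMDl modn_small // => ->.
  apply: (CMove (c' := cfg F')) => // j; have /andP[? ?] := bnd j; exact: FF'.
Qed.

Definition on_track (F : nat -> nat -> V) s P x := forall k, k < 3 -> F s k = track P x k.

Lemma on_track_safe F s P x x' : s < 3 -> on_track F s P x ->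
  (forall s k, s < 3 -> k < 3 -> ~~ step (F s k) x') -> safe P x x'.
Proof. by move=> s3 on un k k3; rewrite -on // un. Qed.

Definition protects P Q (phi : V -> bool) := forall x x', step x x' ->
  legal P x -> legal Q x -> safe P x x' -> safe Q x x' -> phi x' = phi x.

Definition parent v := if [pick u | e u v & lev v == (lev u).+1] is Some u then u else o.

Lemma lev_parentE v : lev (parent v) = (lev v).-1.
Proof.
rewrite /parent; case: pickP => [u /andP[_ /eqP ->] //|no].
rewrite lev_root; case E: (lev v) => [//|m]; have [u lu uv] := lev_parent E.
by have := no u; rewrite uv E lu eqxx.
Qed.

Lemma step_parent v : step v (parent v).
Proof.
rewrite /parent; case: pickP => [u /andP[uv _]|no]; first by rewrite step_sym /Defs.step uv orbT.
case E: (lev v) => [|m]; first by rewrite (lev_eq0 E) step_refl.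
by have [u lu uv] := lev_parent E; have := no u; rewrite uv E lu eqxx.
Qed.

Definition others (s1 s2 s3 : nat) := [/\ [&& s1 < 3, s2 < 3 & s3 < 3], s1 != s2, s1 != s3 & s2 != s3].

(** * Sending the third group to a new geodesic while two groups keep theirs *)

Section Deploy.
Variables (P Q S : seq V) (phi : V -> bool) (s1 s2 s3 : nat).
Hypotheses (gP : geodesic P) (gQ : geodesic Q) (gS : geodesic S).
Hypothesis prot : protects P Q phi.
Hypothesis ds : others s1 s2 s3.
Hypothesis goal : forall F x, on_track F s1 P x -> on_track F s2 Q x -> on_track F s3 S x ->
  legal P x -> legal Q x -> legal S x -> phi x -> robber_loses F x.

Definition kept F x :=
  [/\ on_track F s1 P x /\ on_track F s2 Q x, legal P x, legal Q x & phi x].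

Lemma kept_round (g : V -> nat -> V) F x : kept F x ->
  (forall x' k, step x x' -> k < 3 -> step (F s3 k) (g x' k)) ->
  (forall F' x', step x x' -> (on_track F s3 S x -> legal S x') -> kept F' x' ->
      (forall k, k < 3 -> F' s3 k = g x' k) -> robber_loses F' x') ->
  robber_loses F x.
Proof.
move=> [[on1 on2] lP lQ ph] st H; have [/and3P[l1 l2 l3] n12 n13 n23] := ds.
apply: robber_round => x' xx' un.
have sP := on_track_safe l1 on1 un; have sQ := on_track_safe l2 on2 un.
exists (fun s k => if s == s1 then track P x' k else if s == s2 then track Q x' k else g x' k).
  move=> s k sl kl; case: eqP => [->|/eqP ns1]; first by rewrite on1 // track_step.
  case: eqP => [->|/eqP ns2]; first by rewrite on2 // track_step.
  have -> : s = s3 by move: ns1 ns2 n12 n13 n23; lia.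
  exact: st.
apply: H => //; first by move=> on3; exact: safe_legal xx' (on_track_safe l3 on3 un).
- split; [split=> k kl|exact: safe_legal xx' sP|exact: safe_legal xx' sQ|by rewrite (prot xx')].
    by rewrite eqxx.
  by rewrite eq_sym (negPf n12) eqxx.
- by move=> k kl; rewrite eq_sym (negPf n13) eq_sym (negPf n23).
Qed.

(** Arriving on the track does not yet make [legal S x] true; one further round, survived by the
    robber, does. *)
Lemma deploy_synced F x : kept F x -> on_track F s3 S x -> robber_loses F x.
Proof.
move=> kF on3; apply: (kept_round (g := track S)) kF _ _ => [x' k xx' kl|F' x' xx' lS kF' eF'].
  by rewrite on3 // track_step.
by case: kF' => -[? ?] *; apply: goal => //; exact: lS.
Qed.

(** [m] bounds the number of rounds left. Each cop of the third group gains one index per round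
    unless its target holds it back, and the target moves by at most one, so the lower bound rises
    until it is the target itself. *)
Lemma deploy_climb m F x : kept F x ->
  (forall k, k < 3 -> exists2 j, F s3 k = nth o S j &
     minn (size S - m) (minn (lev x + k).-1 (size S).-1) <= j <= minn (lev x + k).-1 (size S).-1) ->
  robber_loses F x.
Proof.
have S0 : 0 < size S by case: gS.
elim: m F x => [|m IH] F x kF onF.
  apply: deploy_synced kF _ => k kl; have [j -> jb] := onF k kl.
  by rewrite /track; congr nth; move: jb S0; lia.
(* The levels along [S] are distinct, so [index] recovers the positions as a function. *)
pose j k := if k < 3 then
  (index (F s3 k) S) else 0.
have jP k : k < 3 -> F s3 k = nth o S (j k) /\
  minn (size S - m.+1) (minn (lev x + k).-1 (size S).-1) <= j k <= minn (lev x + k).-1 (size S).-1.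
  move=> kl; rewrite /j kl; have [i Fi ib] := onF k kl.
  have iS : i < size S by move: ib S0; lia.
  have uS : uniq S.
    apply/(uniqP o) => a b; rewrite !inE => aS bS eab.
    by case: gS => _ lS _; rewrite -(lS a aS) eab lS.
  by rewrite Fi index_uniq.
apply: (kept_round (g := fun x' k => nth o S (minn (j k).+1 (minn (lev x' + k).-1 (size S).-1)))) kF _ _.
  move=> x' k xx' kl; have [-> jb] := jP k kl.
  have h1 := lev_step xx'; rewrite step_sym in xx'; have h2 := lev_step xx'.
  by apply: geodesic_step => //; move: jb S0 h1 h2; lia.
move=> F' x' xx' _ kF' eF'; apply: IH kF' _ => k kl; eexists; first exact: eF'.
have [_ jb] := jP k kl; have h1 := lev_step xx'; rewrite step_sym in xx'; have h2 := lev_step xx'.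
move: jb S0 h1 h2; lia.
Qed.

(** The third group first returns to the root along [parent], then climbs [S] from index 0. *)
Lemma deploy F0 x0 : kept F0 x0 -> robber_loses F0 x0.
Proof.
have H m : forall F x, kept F x -> (forall k, k < 3 -> lev (F s3 k) <= m) -> robber_loses F x.
  elim: m => [|m IH] F x kF lF.
    apply: (deploy_climb (m := size S)) kF _ => k kl; exists 0; last by rewrite subnn min0n.
    have [S0 lS _] := gS; rewrite (lev_eq0 (conn := conn) (v := F s3 k)); last by have := lF k kl; rewrite leqn0 => /eqP.
    by rewrite (lev_eq0 (lS 0 S0)).
  apply: (kept_round (g := fun _ k => parent (F s3 k))) kF _ _ => [x' k _ _|F' x' _ _ kF' eF'].
    exact: step_parent.
  by apply: IH kF' _ => k kl; rewrite eF' // lev_parentE; have := lF k kl; lia.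
move=> kF; apply: (H (maxn (lev (F0 s3 0)) (maxn (lev (F0 s3 1)) (lev (F0 s3 2))))) kF _.
by case=> [|[|[|]]] // _; lia.
Qed.
End Deploy.

(** The slots are arbitrary, so that groups can exchange their roles whenever one is released. *)
Definition cops_beat P Q (phi : V -> bool) := forall s1 s2 F x, s1 < 3 -> s2 < 3 -> s1 != s2 ->
  on_track F s1 P x -> on_track F s2 Q x -> legal P x -> legal Q x -> phi x -> robber_loses F x.

Lemma third_slot s1 s2 : s1 < 3 -> s2 < 3 -> s1 != s2 -> exists s3, others s1 s2 s3.
Proof. by move=> *; exists (3 - s1 - s2); split; lia. Qed.

Lemma cops_beat_sym P Q phi : cops_beat P Q phi -> cops_beat Q P phi.
Proof. by move=> H s1 s2 F x *; apply: (H s2 s1) => //; rewrite eq_sym. Qed.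

(** The third group is deployed on [S] while [phi] stays true by protection. Then the pair that
    encloses the robber goes on, and the remaining group is free again. *)
Lemma cops_beat_split P S Q phi phi1 phi2 :
  geodesic P -> geodesic S -> geodesic Q -> protects P Q phi ->
  cops_beat P S phi1 -> cops_beat S Q phi2 ->
  (forall x, legal P x -> legal S x -> legal Q x -> phi x -> phi1 x || phi2 x) ->
  cops_beat P Q phi.
Proof.
move=> gP gS gQ prot H1 H2 H s1 s2 F x l1 l2 n12 on1 on2 lP lQ ph.
have [s3 ds] := third_slot l1 l2 n12.
apply: (@deploy P Q S phi s1 s2 s3) => // {F x on1 on2 lP lQ ph}.
move=> F x on1 on2 on3 lP lQ lS ph; have [/and3P[_ _ l3] _ n13 n23] := ds.
by case/orP: (H x lP lS lQ ph) => ?; [apply: (H1 s1 s3)|apply: (H2 s3 s2); rewrite // eq_sym].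
Qed.

Lemma cops_beat_start P Q phi : geodesic P -> geodesic Q ->
  cops_beat P Q phi -> cops_beat P Q (fun x => ~~ phi x) -> cops_win e 9.
Proof.
move=> gP gQ H1 H2; exists (fun=> o) => x0.
case: (boolP (step o x0)) => [ox|nox].
  apply: (CMove (c' := fun=> x0)) => //; apply: RCaught.
  by exists ord0.
apply: (CMove (c' := cfg (fun _ _ => o))); first by move=> i; exact: step_refl.
have on0 F s x : (forall k, k < 3 -> F s k = o) -> on_track F s [:: o] x.
  by move=> Fo k kl; rewrite Fo // /track /= minn0.
have pr R : protects R [:: o] xpredT by [].
(* Groups waiting at the root guard the one-vertex geodesic [[:: o]], with a trivial invariant,
   while first [P] and then [Q] is deployed. *)
apply: (@deploy [:: o] [:: o] P xpredT 0 1 2) => //; try exact: geodesic_nil.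
  move=> F x on1 on2 on3 l1 _ l3 _.
  apply: (@deploy P [:: o] Q xpredT 2 0 1) => //; try exact: geodesic_nil.
  move=> {F x on1 on2 on3 l1 l3} F x on1 on2 on3 l1 l2 l3 _.
  by case E: (phi x); [apply: (H1 2 1)|apply: (H2 2 1) => //; rewrite E].
Qed.
End Guarding.

(** * Spanning trees of a square grid *)

Section GridClosure.
Variable N : nat.
Notation node := ('I_N.+1 * 'I_N.+1)%type.
Notation face := ('I_N * 'I_N)%type.
Notation edge := ('I_N * 'I_N.+1 + 'I_N.+1 * 'I_N)%type.

(* [(true, i, j)] codes the horizontal edge from [(i - 1, j)] to [(i, j)] and [(false, i, j)] the vertical
   one from [(i, j - 1)] to [(i, j)]; the unit square whose upper right corner is [(i, j)] has index
   [(i, j)], so that squares have indices in [1 .. N]. *)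
Definition code (d : edge) : bool * nat * nat :=
  match d with inl (i, j) => (true, i.+1, j : nat) | inr (i, j) => (false, i : nat, j.+1) end.

Definition end1 (d : edge) : node := match d with
  | inl (i, j) => (widen_ord (leqnSn N) i, j) | inr (i, j) => (i, widen_ord (leqnSn N) j) end.
Definition end2 (d : edge) : node := match d with
  | inl (i, j) => (lift ord0 i, j) | inr (i, j) => (i, lift ord0 j) end.
Definition joins d (u v : node) := ((end1 d == u) && (end2 d == v)) || ((end1 d == v) && (end2 d == u)).

(** Squares outside the grid count as absent, so that edges on the border need no special
    treatment. *)
Definition squares (J : {set face}) (i j : nat) : bool :=
  [exists p in J, (p.1.+1 == i :> nat) && (p.2.+1 == j :> nat)].

(** The boundary mod 2: an edge belongs to it if exactly one of the two squares beside it does. *)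
Definition bdry (f : nat -> nat -> bool) (c : bool * nat * nat) :=
  let: (b, i, j) := c in if b then f i j.+1 (+) f i j else f i.+1 j (+) f i j.

Lemma squaresE J (p : face) : squares J p.1.+1 p.2.+1 = (p \in J).
Proof.
apply/existsP/idP => [[q /and3P[qJ]]|pJ]; last by exists p; rewrite pJ !eqxx.
rewrite !eqSS => /eqP q1 /eqP q2; suff -> : p = q by [].
by case: p q {qJ} q1 q2 => [a b] [a' b'] /= /val_inj -> /val_inj ->.
Qed.

Lemma squares_out J i j : ~~ ((0 < i <= N) && (0 < j <= N)) -> squares J i j = false.
Proof.
move=> H; apply/negbTE; apply: contra H => /existsP[p /and3P[_ /eqP <- /eqP <-]].
by rewrite !ltn_ord.
Qed.

Lemma squaresP J i j : squares J i j -> exists2 p : face, p \in J & (p.1.+1 = i :> nat /\ p.2.+1 = j :> nat).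
Proof. by case/existsP=> p /and3P[pJ /eqP ? /eqP ?]; exists p. Qed.

Lemma squares_set (h : nat -> nat -> bool) : (forall i j, h i j -> (0 < i <= N) && (0 < j <= N)) ->
  squares [set p : face | h p.1.+1 p.2.+1] =2 h.
Proof.
move=> hs i j; case: (boolP ((0 < i <= N) && (0 < j <= N))) => [|out].
  case: i j => [|i] [|j] //=; rewrite ?andbF //= => /andP[iN jN].
  by rewrite (squaresE _ (Ordinal iN, Ordinal jN)) inE.
by rewrite squares_out //; apply/esym/negbTE; apply: contra out; exact: hs.
Qed.

Lemma bdry_code J c : bdry (squares J) c -> exists d, code d = c.
Proof.
have sq i j : squares J i j -> (0 < i <= N) && (0 < j <= N).
  by case: (boolP ((0 < i <= N) && (0 < j <= N))) => // /squares_out ->.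
case: c => [[[] i] j] /=.
- case E1: (squares J i j.+1); case E2: (squares J i j) => //= _.
  + have := sq _ _ E1; case: i {E1 E2} => // i ij.
    have iN : i < N by lia. have jN : j < N.+1 by lia.
    by exists (inl (Ordinal iN, Ordinal jN)).
  + have := sq _ _ E2; case: i {E1 E2} => // i ij.
    have iN : i < N by lia. have jN : j < N.+1 by lia.
    by exists (inl (Ordinal iN, Ordinal jN)).
- case E1: (squares J i.+1 j); case E2: (squares J i j) => //= _.
  + have := sq _ _ E1; case: j {E1 E2} => [|j] ij; first by lia.
    have iN : i < N.+1 by lia. have jN : j < N by lia.
    by exists (inr (Ordinal iN, Ordinal jN)).
  + have := sq _ _ E2; case: j {E1 E2} => [|j] ij; first by lia.
    have iN : i < N.+1 by lia. have jN : j < N by lia.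
    by exists (inr (Ordinal iN, Ordinal jN)).
Qed.

Definition star (y : node) : seq (bool * nat * nat) :=
  [:: (true, y.1 : nat, y.2 : nat); (true, y.1.+1, y.2 : nat);
      (false, y.1 : nat, y.2 : nat); (false, y.1 : nat, y.2.+1)].

Lemma star_joins y d : (code d \in star y) = (y == end1 d) || (y == end2 d).
Proof.
case: y => [[a ha] [b hb]]; case: d => [] [[i hi] [j hj]].
all: rewrite !inE /= !xpair_eqE /= -!val_eqE /= /bump /=.
all: rewrite ?eqSS ?add1n; lia.
Qed.

(** Boundaries are cycles mod 2: each of the four squares around a node has two of the edges at this
    node. *)
Lemma star_bdry f (y : node) : \big[addb/false]_(c <- star y) bdry f c = false.
Proof.
rewrite /star !big_cons big_nil /=.
by case: (f _ _); case: (f _ _); case: (f _ _); case: (f _ _).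
Qed.

Lemma star_uniq y : uniq (star y).
Proof. by rewrite /= !inE /= !xpair_eqE /= !eqxx; lia. Qed.

Lemma star_other f y c : c \in star y -> bdry f c ->
  exists2 c', c' \in star y & (c' != c) && bdry f c'.
Proof.
move=> cy bc; apply/hasP; apply/negPn/negP => /hasPn H.
have := star_bdry f y; rewrite (bigD1_seq c) ?star_uniq //= bc big1_seq // => c' /andP[nc c's].
by have := H c' c's; rewrite nc /= => /negbTE.
Qed.

Lemma code_inj : injective code.
Proof. by move=> [[i j]|[i j]] [[k l]|[k l]] //= [] /val_inj -> /val_inj ->. Qed.

(** * Spanning tree, cotree and the region cut off by a cotree edge *)

Section Tree.
Variables (t : rel node) (root : node).
Hypothesis conn : forall v, connect t root v.
Hypothesis tj : forall u v, t u v -> exists d, joins d u v.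

Definition up_edge (v : node) : option edge := [pick d | [exists u,
  [&& t u v, lev conn v == (lev conn u).+1 & joins d u v]]].

Definition tree : {set edge} := locked [set d | [exists v, up_edge v == Some d]].

Lemma mem_tree d : (d \in tree) = [exists v, up_edge v == Some d].
Proof. by rewrite /tree -lock inE. Qed.

Lemma up_edgeP v d : up_edge v = Some d ->
  exists u, [/\ t u v, lev conn v = (lev conn u).+1 & joins d u v].
Proof.
by rewrite /up_edge; case: pickP => // d' /existsP[u /and3P[tu /eqP lu jn]] [<-]; exists u.
Qed.

Lemma up_edge_some v : v != root -> exists d, up_edge v = Some d.
Proof.
move=> vr; rewrite /up_edge; case: pickP => [d _|no]; first by exists d.
case E: (lev conn v) => [|m]; first by rewrite (lev_eq0 E) eqxx in vr.
have [u lu tu] := lev_parent E; have [d jn] := tj tu.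
by have := no d; move/existsP => []; exists u; rewrite tu jn E lu eqxx.
Qed.

Lemma joins_ends d u v u' v' : joins d u v -> joins d u' v' -> (u = u' /\ v = v') \/ (u = v' /\ v = u').
Proof. by rewrite /joins => /orP[] /andP[/eqP <- /eqP <-] /orP[] /andP[/eqP <- /eqP <-]; auto. Qed.

Lemma up_edge_inj v v' d : up_edge v = Some d -> up_edge v' = Some d -> v = v'.
Proof.
move=> /up_edgeP[u [_ lu ju]] /up_edgeP[u' [_ lu' ju']].
case: (joins_ends ju ju') => -[] // uv vu; subst; lia.
Qed.

(** The tree has one edge for each node but the root; [2 N (N + 1)] edges less [(N + 1)^2 - 1] leave
    [N^2]. *)
Lemma card_cotree : #|~: tree| = #|{: face}|.
Proof.
have ct : #|tree| = #|[set~ root]|.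
  rewrite -(card_imset _ (@Some_inj _)) -(card_in_imset (f := up_edge)); last first.
    move=> v v'; rewrite !inE => vr _ eq; have [d ud] := up_edge_some vr.
    by apply: (up_edge_inj ud); rewrite -eq.
  apply: eq_card => x; apply/imsetP/imsetP => [[d]|[v]].
    by rewrite mem_tree => /existsP[v /eqP ud] ->; exists v => //; rewrite !inE;
      apply/eqP => vr; have [u [_ ]] := up_edgeP ud; rewrite vr lev_root.
  rewrite !inE => vr ->; have [d ud] := up_edge_some vr; exists d => //.
  by rewrite mem_tree; apply/existsP; exists v; rewrite ud.
have := cardsC tree; rewrite ct cardsC1 card_sum !card_prod !card_ord.
by move=> H; have : N.+1 * N.+1 > 0 by []; lia.
Qed.

Lemma up_edge_star v d : up_edge v = Some d -> code d \in star v.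
Proof.
by case/up_edgeP=> u [_ _]; rewrite star_joins /joins => /orP[/andP[_ /eqP <-]|/andP[/eqP <- _]]; rewrite eqxx ?orbT.
Qed.

(** A nonempty forest has a leaf, whereas a boundary has an even number of edges at each node. *)
Lemma bdry_tree0 J : (forall d, bdry (squares J) (code d) -> d \in tree) -> J = set0.
Proof.
move=> H.
have H0 d : bdry (squares J) (code d) = false.
  apply/negP => bd; have := H d bd; rewrite mem_tree => /existsP[v /eqP vd].
  pose P v := if up_edge v is Some d' then bdry (squares J) (code d') else false.
  have Pv : P v by rewrite /P vd.
  (* Take [v] farthest from the root with its upward edge in the boundary. By parity a second
     boundary edge leaves [v]; it is the upward edge of a node farther still. *)
  case: (arg_maxnP (lev conn) Pv) => {v vd Pv} {}v.
  rewrite /P; case E: (up_edge v) => [d'|//] bd' mx.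
  have [c cs /andP[nc bc]] := star_other (up_edge_star E) bd'.
  have [d1 dc] := bdry_code bc; subst c; have := H d1 bc; rewrite mem_tree => /existsP[w /eqP wd].
  have [u [_ lu jn]] := up_edgeP wd.
  have : v = w \/ v = u.
    by move: cs jn; rewrite star_joins /joins => /orP[] /eqP -> /orP[] /andP[/eqP e1 /eqP e2]; rewrite ?e1 ?e2; auto.
  case=> vw; last by have := mx w; rewrite /P wd vw lu => /(_ bc) /=; lia.
  by move: wd nc; rewrite -vw E => -[->]; rewrite eqxx.
apply/setP => p; rewrite inE -squaresE.
have S0 : forall i j, squares J i j = false.
  (* An empty boundary forces emptiness column by column, starting from column 0, which is outside
     the grid. *)
  elim=> [|i IH] j; first by rewrite squares_out.
  case: (boolP ((0 < i.+1 <= N) && (0 < j <= N))) => [ij|]; last exact: squares_out.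
  case: j ij => [|j] ij; first by rewrite andbF in ij.
  have iN : i < N.+1 by lia. have jN : j < N by lia.
  by have := H0 (inr (Ordinal iN, Ordinal jN)); rewrite /= IH addbF.
exact: S0.
Qed.

(** The map from sets of squares to the part of their boundary outside the tree is additive mod 2
    and injective by [bdry_tree0]. By [card_cotree] it is onto, so it takes the value [[set d]]. *)
Lemma filling d : d \notin tree -> exists I : {set face},
  bdry (squares I) (code d) /\ forall d', d' \notin tree -> d' != d -> bdry (squares I) (code d') = false.
Proof.
move=> dt; pose g (J : {set face}) := [set d in ~: tree | bdry (squares J) (code d)].
have ginj : injective g.
  move=> J1 J2 eg; pose h i j := squares J1 i j (+) squares J2 i j.
  have hs i j : h i j -> (0 < i <= N) && (0 < j <= N).
    case: (boolP ((0 < i <= N) && (0 < j <= N))) => // out.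
    by rewrite /h !squares_out.
  have J0 : [set p : face | h p.1.+1 p.2.+1] = set0.
    apply: bdry_tree0 => d'; apply: contraLR => nt.
    have /setP /(_ d') := eg; rewrite !inE nt /=.
    have eb : bdry (squares [set p : face | h p.1.+1 p.2.+1]) (code d') =
      bdry (squares J1) (code d') (+) bdry (squares J2) (code d').
      case: (code d') => [[[] i] j] /=; rewrite !squares_set // /h;
      by do 4!case: (squares _ _ _).
    by rewrite eb => ->; rewrite addbb.
  apply/setP => p; have /setP /(_ p) := J0; rewrite !inE /h !squaresE => /negbT.
  by case: (p \in J1); case: (p \in J2).
have im : g @: setT = powerset (~: tree).
  apply/eqP; rewrite eqEcard card_powerset card_cotree card_imset // -powersetT card_powerset cardsT leqnn andbT.
  by apply/subsetP => _ /imsetP[J _ ->]; rewrite inE; apply/subsetP => d'; rewrite inE => /andP[].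
have : [set d] \in g @: setT by rewrite im inE sub1set inE.
case/imsetP => I _ dI; exists I; split.
  by have /setP /(_ d) := dI; rewrite !inE eqxx dt /= => <-.
by move=> d' nt nd; have /setP /(_ d') := dI; rewrite !inE (negPf nd) nt.
Qed.

Definition square_sides (p : face) : seq (bool * nat * nat) :=
  let i := p.1 : nat in let j := p.2 : nat in
  [:: (true, i.+1, j); (true, i.+1, j.+1); (false, i, j.+1); (false, i.+1, j.+1)].

Lemma bdry_sides c : exists A B : nat * nat, forall f, bdry f c = f A.1 A.2 (+) f B.1 B.2.
Proof. by case: c => [[[] i] j]; [exists (i, j.+1), (i, j)|exists (i.+1, j), (i, j)]. Qed.

Lemma side_bdry p c : c \in square_sides p ->
  exists k l, forall f, bdry f c = f p.1.+1 p.2.+1 (+) f k l.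
Proof.
rewrite !inE => /or4P[] /eqP ->; [exists p.1.+1, p.2|exists p.1.+1, p.2.+2|exists p.1, p.2.+1|exists p.1.+2, p.2.+1] => f //=.
all: by rewrite addbC.
Qed.

Variable E : edge -> Prop.
Hypothesis tE : forall u v d, t u v -> joins d u v -> E d.
Hypothesis squareE : forall (p : face) d, code d \in square_sides p ->
  (forall d', code d' \in square_sides p -> d' != d -> E d') -> E d.

(* The dual of the complement of a spanning tree is a tree, so that the edges outside the spanning tree can
   be added one at a time, each closing a square: [filling] is the part of the dual tree cut off by an edge. *)
Lemma grid_closure d : E d.
Proof.
have treeE d' : d' \in tree -> E d'.
  by rewrite mem_tree => /existsP[v /eqP /up_edgeP[u [tu _ jn]]]; exact: tE tu jn.
suff H m d' (I : {set face}) : #|I| <= m -> d' \notin tree -> bdry (squares I) (code d') ->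
   (forall d'', d'' \notin tree -> d'' != d' -> bdry (squares I) (code d'') = false) -> E d'.
  case: (boolP (d \in tree)) => [/treeE //|nt]; have [I [b1 b2]] := filling nt.
  exact: (H _ d I (leqnn _)).
elim: m d' I => [|m IH] {}d I Im nt bd bn.
  have I0 : I = set0 by apply/eqP; rewrite -cards_eq0; lia.
  suff S0 i j : squares I i j = false by move: bd; case: (code d) => [[[] i] j] /=; rewrite !S0.
  by rewrite I0; apply/negbTE/negP => /squaresP[p]; rewrite inE.
have [p pI ps] : exists2 p, p \in I & code d \in square_sides p.
  move: bd; case Ed: (code d) => [[b i] j] /= bd.
  have [k [l [sI kl]]] : exists k l, squares I k l /\
      (if b then (k == i) && ((l == j.+1) || (l == j)) else (l == j) && ((k == i.+1) || (k == i))).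
    case: b bd {Ed}.
    - case E1: (squares I i j.+1) => /= bd; first by exists i, j.+1; rewrite !eqxx.
      by exists i, j; rewrite !eqxx orbT.
    - case E1: (squares I i.+1 j) => /= bd; first by exists i.+1, j; rewrite !eqxx.
      by exists i, j; rewrite !eqxx orbT.
  have [p pI [pk pl]] := squaresP sI; exists p => //; move: kl.
  rewrite -pk -pl /square_sides !inE /= !xpair_eqE /= !eqSS.
  by case: b {bd Ed} => /=; lia.
(* A further side [d'] of [p] outside the tree has a filling [I'] properly contained in [I], so the
   induction hypothesis covers it. *)
apply: (squareE ps) => d' ps' dd'; case: (boolP (d' \in tree)) => [/treeE //|nt'].
have [I' [b1' b2']] := filling nt'; apply: (IH d' I') => //.
have [k [l eP]] := side_bdry ps; have [k' [l' eP']] := side_bdry ps'.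
have fP : squares I p.1.+1 p.2.+1 by rewrite squaresE.
have fF : squares I k l = false by move: bd; rewrite eP fP /=; case: (squares I k l).
have fF' : squares I k' l' by have := bn _ nt' dd'; rewrite eP' fP /=; case: (squares I k' l').
have b1 : squares I' p.1.+1 p.2.+1 (+) squares I' k' l' by rewrite -eP'.
have b2 : squares I' p.1.+1 p.2.+1 = squares I' k l.
  have /b2' : d \notin tree by [].
  by rewrite eq_sym => /(_ dd'); rewrite eP; do 2!case: (squares _ _ _).
(* Outside the tree, a Boolean combination of [I] and [I'] can have only [d] and [d'] in its
   boundary. The conditions on [h] exclude these two, so the combination is empty by [bdry_tree0].
   If [p] is in [I'] this applies to the union, which is absurd; otherwise it applies to [I'] minus
   [I]. *)
have tree0 (h : bool -> bool -> bool) : h false false = false ->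
   h true (squares I' p.1.+1 p.2.+1) = h false (squares I' k l) ->
   h true (squares I' p.1.+1 p.2.+1) = h true (squares I' k' l') ->
   forall q, h (q \in I) (q \in I') = false.
  move=> h0 h1 h2; pose g i j := h (squares I i j) (squares I' i j).
  have gs i j : g i j -> (0 < i <= N) && (0 < j <= N).
    case: (boolP ((0 < i <= N) && (0 < j <= N))) => // out.
    by rewrite /g !squares_out // h0.
  have J0 : [set q : face | g q.1.+1 q.2.+1] = set0.
    apply: bdry_tree0 => d2; apply: contraLR => nt2.
    have -> : bdry (squares [set q : face | g q.1.+1 q.2.+1]) (code d2) = bdry g (code d2).
      by case: (code d2) => [[[] i] j] /=; rewrite !squares_set.
    have [->|n1] := eqVneq d2 d; first by rewrite eP /g fP fF h1 addbb.
    have [->|n2] := eqVneq d2 d'; first by rewrite eP' /g fP fF' h2 addbb.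
    have := bn _ nt2 n1; have := b2' _ nt2 n2; have [[i1 j1] [[i2 j2] eb]] := bdry_sides (code d2).
    by rewrite !eb /g /=; do 4!case: (squares _ _ _) => //=; rewrite addbb.
  by move=> q; have /setP /(_ q) := J0; rewrite !inE /g !squaresE.
case fP' : (squares I' p.1.+1 p.2.+1) b1 b2 => b1 b2.
  have := tree0 orb erefl; rewrite fP' -b2 => /(_ erefl erefl p).
  by rewrite pI.
have sub : I' \proper I.
  apply/properP; split; last by exists p => //; rewrite -squaresE fP'.
  apply/subsetP => q qI'; have := tree0 (fun x y => ~~ x && y) erefl; rewrite fP' -b2 => /(_ erefl erefl q).
  by rewrite qI' andbT => /negbFE.
exact: leq_trans (proper_card sub) Im.
Qed.
End Tree.
End GridClosure.

(** * Segments and winding parities in the plane *)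

Section Plane.
Local Open Scope R_scope.
Implicit Types (p q a b c x y z : R * R).

Lemma dist2_ge0 p q : 0 <= dist2 p q.
Proof. exact: sqrt_pos. Qed.

Lemma dist2_sym p q : dist2 p q = dist2 q p.
Proof. by rewrite /dist2; congr sqrt; ring. Qed.

Lemma dist2_refl p : dist2 p p = 0.
Proof. by rewrite /dist2 !Rminus_diag /= !Rmult_0_l Rplus_0_l sqrt_0. Qed.

Definition comb (p : R * R) (s : R) (q : R * R) (t : R) : R * R :=
  (s * p.1 + t * q.1, s * p.2 + t * q.2).

Definition norm (p : R * R) := sqrt (p.1 ^ 2 + p.2 ^ 2).

Lemma norm_ge0 p : 0 <= norm p. Proof. exact: sqrt_pos. Qed.

Lemma norm_sq p : norm p ^ 2 = p.1 ^ 2 + p.2 ^ 2.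
Proof. by rewrite /norm pow2_sqrt //; nra. Qed.

Lemma norm_comb p s q t : 0 <= s -> 0 <= t -> norm (comb p s q t) <= s * norm p + t * norm q.
Proof.
move=> s0 t0; have := norm_ge0 p; have := norm_ge0 q; have := norm_sq p; have := norm_sq q.
have := norm_ge0 (comb p s q t); have := norm_sq (comb p s q t).
move: (norm _) (norm p) (norm q) => n u v; move: p q => [p1 p2] [q1 q2].
rewrite [(comb _ _ _ _).1]/= [(comb _ _ _ _).2]/= ![(_, _).1]/= ![(_, _).2]/= => en n0 ev eu v0 u0.
have cs : p1 * q1 + p2 * q2 <= u * v.
  have : (p1 * q1 + p2 * q2) ^ 2 <= (u * v) ^ 2.
    by rewrite Rpow_mult_distr eu ev; have := pow2_ge_0 (p1 * q2 - p2 * q1); nra.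
  have := Rmult_le_pos _ _ u0 v0; move: (u * v) (_ + _) => X Y; nra.
have : n ^ 2 <= (s * u + t * v) ^ 2.
  have := Rmult_le_compat_l (s * t) _ _ (Rmult_le_pos _ _ s0 t0) cs; nra.
have := Rmult_le_pos _ _ s0 u0; have := Rmult_le_pos _ _ t0 v0; move: (s * u) (t * v) => X Y; nra.
Qed.

Lemma dist2E p q : dist2 p q = norm (comb p 1 q (-1)).
Proof. by rewrite /dist2 /norm /=; congr sqrt; ring. Qed.

Lemma dist2_tri p q z : dist2 p z <= dist2 p q + dist2 q z.
Proof.
rewrite !dist2E.
have -> : comb p 1 z (-1) = comb (comb p 1 q (-1)) 1 (comb q 1 z (-1)) 1.
  by rewrite /comb /=; congr (_, _); ring.
by have := @norm_comb (comb p 1 q (-1)) 1 (comb q 1 z (-1)) 1; lra.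
Qed.

Definition bary a s b t c w : R * R := comb (comb a s b t) 1 c w.

Lemma dist2_bary a s b t c w z : 0 <= s -> 0 <= t -> 0 <= w -> s + t + w = 1 ->
  dist2 (bary a s b t c w) z <= s * dist2 a z + t * dist2 b z + w * dist2 c z.
Proof.
move=> s0 t0 w0 e; rewrite !dist2E.
have -> : comb (bary a s b t c w) 1 z (-1) =
   comb (comb (comb a 1 z (-1)) s (comb b 1 z (-1)) t) 1 (comb c 1 z (-1)) w.
  have -> : w = 1 - s - t by lra.
  by rewrite /bary /comb /=; congr (_, _); ring.
apply: Rle_trans (norm_comb _ _ _ _) _ => //; first by lra.
by have := norm_comb (comb a 1 z (-1)) (comb b 1 z (-1)) s0 t0; lra.
Qed.

Definition lerp p q s := comb p (1 - s) q s.

Lemma dist2_lerp_l p q s : 0 <= s -> dist2 p (lerp p q s) = s * dist2 p q.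
Proof.
move=> s0; rewrite /dist2 /=.
have -> : (p.1 - ((1 - s) * p.1 + s * q.1)) ^ 2 + (p.2 - ((1 - s) * p.2 + s * q.2)) ^ 2 =
  Rsqr s * ((p.1 - q.1) ^ 2 + (p.2 - q.2) ^ 2) by rewrite /Rsqr; ring.
rewrite sqrt_mult; [by rewrite sqrt_Rsqr|exact: Rle_0_sqr|].
by have := pow2_ge_0 (p.1 - q.1); have := pow2_ge_0 (p.2 - q.2); lra.
Qed.

Lemma lerpC p q s : lerp p q s = lerp q p (1 - s).
Proof. by rewrite /lerp /comb; congr (_, _); ring. Qed.

Lemma dist2_lerp_r p q s : s <= 1 -> dist2 q (lerp p q s) = (1 - s) * dist2 p q.
Proof. by move=> s1; rewrite lerpC dist2_lerp_l ?(dist2_sym q) //; lra. Qed.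

Definition meets a b c d := exists s t, [/\ 0 <= s <= 1, 0 <= t <= 1 & lerp a b s = lerp c d t].

(** Triangle inequalities through the crossing point give [ac + bd <= ab + cd <= 2 r], and likewise
    for [ad + bc]. *)
Lemma meets_sides a b c d r : meets a b c d -> dist2 a b <= r -> dist2 c d <= r ->
  (dist2 a c <= r \/ dist2 b d <= r) /\ (dist2 a d <= r \/ dist2 b c <= r).
Proof.
move=> [s [t [s01 t01 e]]] ab cd.
have as_ := dist2_lerp_l a b (proj1 s01); have bs := dist2_lerp_r a b (proj2 s01).
have ct := dist2_lerp_l c d (proj1 t01); have dt := dist2_lerp_r c d (proj2 t01).
rewrite e in as_ bs; move: (lerp c d t) as_ bs ct dt => m am bm cm dm.
have := dist2_tri a m c; have := dist2_tri b m d; have := dist2_tri a m d; have := dist2_tri b m c.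
rewrite !(dist2_sym m) am bm cm dm => h1 h2 h3 h4.
by split; [case: (Rle_dec (dist2 a c) r)|case: (Rle_dec (dist2 a d) r)] => ?; [left|right|left|right] => //; lra.
Qed.

Lemma meetsC a b c d : meets a b c d -> meets b a c d.
Proof. by move=> [s [t [s01 t01 e]]]; exists (1 - s), t; split=> //; [lra|rewrite -lerpC]. Qed.

Lemma meets_sym a b c d : meets a b c d -> meets c d a b.
Proof. by move=> [s [t [s01 t01 e]]]; exists t, s. Qed.

Definition orient a b c := (b.1 - a.1) * (c.2 - a.2) - (b.2 - a.2) * (c.1 - a.1).

(** By Cramer's rule the two quotients are the parameters of the intersection point on the two
    lines. *)
Lemma meets_orient a b x y : let K := orient x y a - orient x y b in
  K <> 0 -> 0 <= orient x y a / K <= 1 -> 0 <= - orient a b x / K <= 1 -> meets a b x y.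
Proof.
move=> K K0 h1 h2; exists (orient x y a / K), (- orient a b x / K); split=> //.
by rewrite /lerp /comb; congr (_, _); field_simplify => //; congr (_ / _); rewrite /K /orient; ring.
Qed.

Lemma div01 u k : 0 < k -> 0 <= u <= k -> 0 <= u / k <= 1.
Proof.
move=> k0 uk; split; first by apply: Rmult_le_pos; [lra|exact: Rlt_le (Rinv_0_lt_compat _ k0)].
apply: (Rmult_le_reg_r k) => //; rewrite /Rdiv Rmult_assoc Rinv_l; lra.
Qed.

Lemma meets_pos a b x y : let K := orient x y a - orient x y b in
  0 < K -> 0 <= orient x y a <= K -> 0 <= - orient a b x <= K -> meets a b x y.
Proof. by move=> K K0 h1 h2; apply: meets_orient; [exact: Rgt_not_eq| |]; apply: div01. Qed.

Lemma meets_neg a b x y : let K := orient x y b - orient x y a in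
  0 < K -> 0 <= - orient x y a <= K -> 0 <= orient a b x <= K -> meets a b x y.
Proof.
move=> K K0 h1 h2; apply: meets_orient; first by apply: Rlt_not_eq; rewrite /K in K0; lra.
- have -> : orient x y a / (orient x y a - orient x y b) = - orient x y a / K.
    by rewrite /K; field; rewrite /K in K0; lra.
  exact: div01.
- have -> : - orient a b x / (orient x y a - orient x y b) = orient a b x / K.
    by rewrite /K; field; rewrite /K in K0; lra.
  exact: div01.
Qed.

(** * Crossing parities with vertical rays *)

Definition Rleb (u v : R) : bool := if Rle_dec u v then true else false.
Definition Rltb (u v : R) : bool := if Rlt_dec u v then true else false.

Lemma RlebP u v : reflect (u <= v) (Rleb u v).
Proof. by rewrite /Rleb; case: Rle_dec => ?; constructor. Qed.
Lemma RltbP u v : reflect (u < v) (Rltb u v).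
Proof. by rewrite /Rltb; case: Rlt_dec => ?; constructor. Qed.

(* [ray x a b]: the segment [a, b] crosses the vertical ray going up from [x], shifted infinitesimally to the
   right so that it avoids [a] and [b]. *)
Definition ray x a b : bool := (Rleb a.1 x.1 (+) Rleb b.1 x.1) &&
  (if Rleb a.1 x.1 then Rltb (orient a b x) 0 else Rltb 0 (orient a b x)).

(* [strip x y a]: [a] lies above the segment [x, y], between the two shifted rays. *)
Definition strip x y a : bool := (Rleb a.1 x.1 (+) Rleb a.1 y.1) &&
  (if Rleb a.1 x.1 then Rltb (orient x y a) 0 else Rltb 0 (orient x y a)).

Lemma orient_swap a b c : orient b a c = - orient a b c.
Proof. by rewrite /orient; ring. Qed.

Lemma ray_sym x a b : ray x a b = ray x b a.
Proof.
rewrite /ray (orient_swap b a); case: (RlebP a.1 x.1) => h1; case: (RlebP b.1 x.1) => h2 //=.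
all: by do 2!case: RltbP => //=; lra.
Qed.

Lemma strip_sym x y a : strip x y a = strip y x a.
Proof.
rewrite /strip (orient_swap x y); case: (RlebP a.1 x.1) => h1; case: (RlebP a.1 y.1) => h2 //=.
all: by do 2!case: RltbP => //=; lra.
Qed.

(** The shifted rays from [x] and [y] and the segment [[x, y]] bound the strip. A segment that
    avoids [[x, y]] thus crosses the two rays an odd number of times exactly if one of its ends is
    in the strip. *)
Lemma ray_move_aux a b x y : x.1 <= y.1 -> a.1 <= b.1 -> ~ meets a b x y ->
  ray x a b (+) ray y a b = strip x y a (+) strip x y b.
Proof.
move=> xy ab nm.
have mp := @meets_pos a b x y; have mn := @meets_neg a b x y.
(* These two identities are all the geometry that remains once the orientations become variables;
   the cases are then settled by signs. *)
have e1 : orient x y a - orient x y b = orient a b y - orient a b x by rewrite /orient; ring.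
have e2 : (orient x y a - orient x y b) * (a.1 - x.1) + orient x y a * (b.1 - a.1) +
  orient a b x * (y.1 - x.1) = 0 by rewrite /orient; ring.
rewrite /ray /strip; move: mp mn e1 e2.
move: (orient x y a) (orient x y b) (orient a b x) (orient a b y) => A B C D mp mn e1 e2.
have {mp}mp : 0 < A - B -> 0 <= A <= A - B -> 0 <= - C <= A - B -> False by move=> *; apply: nm; exact: mp.
have {mn nm}mn : 0 < B - A -> 0 <= - A <= B - A -> 0 <= C <= B - A -> False by move=> *; apply: nm; exact: mn.
case: (RlebP a.1 x.1) => h1; case: (RlebP a.1 y.1) => h2; case: (RlebP b.1 x.1) => h3;
  case: (RlebP b.1 y.1) => h4 //=; try (exfalso; lra).
all: move: (a.1) (b.1) (x.1) (y.1) xy ab e2 h1 h2 h3 h4 => u v p q *.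
- case: RltbP => hC; case: RltbP => hB //=; exfalso.
  + have A0 : 0 < A by nra.
    by apply: mp; nra.
  + have A0 : A <= 0 by nra.
    by apply: mn; nra.
- case: RltbP => hC; case: RltbP => hD //=; exfalso.
  + have A0 : 0 <= A by nra.
    by apply: mp; nra.
  + have A0 : A <= 0 by nra.
    by apply: mn; nra.
- case: RltbP => hA; case: RltbP => hB //=; exfalso.
  + have C0 : C <= 0 by nra.
    by apply: mp; nra.
  + have C0 : 0 <= C by nra.
    by apply: mn; nra.
- case: RltbP => hD; case: RltbP => hA //=; exfalso.
  + have C0 : 0 <= C by nra.
    by apply: mn; nra.
  + have C0 : C <= 0 by nra.
    by apply: mp; nra.
Qed.

Lemma ray_move a b x y : ~ meets a b x y -> ray x a b (+) ray y a b = strip x y a (+) strip x y b.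
Proof.
wlog xy : x y / x.1 <= y.1 => [H|].
  case: (Rle_dec x.1 y.1) => xy nm; first exact: H.
  rewrite addbC H; [by rewrite !(strip_sym y)|lra|].
  by move=> m; apply: nm; apply/meets_sym/meetsC/meets_sym.
case: (Rle_dec a.1 b.1) => ab nm; first exact: ray_move_aux.
rewrite !(ray_sym _ a) addbC [RHS]addbC addbC; apply: ray_move_aux => //; first by lra.
by move=> m; apply: nm; exact: meetsC.
Qed.

Lemma bary_perm1 a s b t c w : bary a s b t c w = bary b t a s c w.
Proof. by rewrite /bary /comb /=; congr (_, _); ring. Qed.
Lemma bary_perm2 a s b t c w : bary a s b t c w = bary c w b t a s.
Proof. by rewrite /bary /comb /=; congr (_, _); ring. Qed.

Definition in_triangle x a b c :=
  exists s t w, [/\ 0 <= s, 0 <= t, 0 <= w, s + t + w = 1 & x = bary a s b t c w].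

Lemma cramer x a b c : orient a b c <> 0 ->
  0 <= - orient a c x / orient a b c -> 0 <= orient a b x / orient a b c ->
  - orient a c x / orient a b c + orient a b x / orient a b c <= 1 -> in_triangle x a b c.
Proof.
set t := - orient a c x / _; set w := orient a b x / _ => D0 t0 w0 tw.
exists (1 - t - w), t, w; split=> //; try lra.
have e (u v p q : R) : orient a b c * (u - v) = - orient a c x * (p - v) + orient a b x * (q - v) ->
    u = 1 * ((1 - t - w) * v + t * p) + w * q.
  by move=> e; have -> : u = v + (orient a b c * (u - v)) / orient a b c; [field|rewrite e /t /w; field].
by rewrite [LHS]surjective_pairing /bary /comb /=; congr (_, _); apply: e; rewrite /orient; ring.
Qed.

(** The vertical line at [x] separates [a] from [b] and [c], and exactly one of the sides at [a]
    passes above [x]. The resulting signs make the barycentric coordinates from [cramer]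
    nonnegative. *)
Lemma ray_triangle_aux x a b c : Rleb a.1 x.1 != Rleb b.1 x.1 -> Rleb a.1 x.1 != Rleb c.1 x.1 ->
  ray x a b (+) ray x a c -> in_triangle x a b c.
Proof.
rewrite /ray => h1 h2.
have ei : orient a b c * (x.1 - a.1) = - orient a c x * (b.1 - a.1) + orient a b x * (c.1 - a.1).
  by rewrite /orient; ring.
have K : orient a b c <> 0 /\ 0 <= - orient a c x / orient a b c /\ 0 <= orient a b x / orient a b c /\
  - orient a c x / orient a b c + orient a b x / orient a b c <= 1 -> in_triangle x a b c.
  by move=> [? [? [? ?]]]; exact: cramer.
move=> H; apply: K; move: h1 h2 H ei.
move: (orient a b c) (orient a c x) (orient a b x) => D W U.
have pos u k : 0 < k -> 0 <= u -> 0 <= u / k.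
  by move=> k0 u0; apply: Rmult_le_pos => //; exact: Rlt_le (Rinv_0_lt_compat _ k0).
have fin : 0 < D -> 0 <= - W -> 0 <= U -> - W + U <= D ->
    D <> 0 /\ 0 <= - W / D /\ 0 <= U / D /\ - W / D + U / D <= 1.
  move=> d w u le; split; first exact: Rgt_not_eq.
  split; first exact: pos. split; first exact: pos.
  have -> : - W / D + U / D = (- W + U) / D by field; lra.
  by have [] := @div01 (- W + U) D d; lra.
have fin' : D < 0 -> - W <= 0 -> U <= 0 -> D <= - W + U ->
    D <> 0 /\ 0 <= - W / D /\ 0 <= U / D /\ - W / D + U / D <= 1.
  move=> d w u le; have dd : D <> 0 by exact: Rlt_not_eq.
  split=> //.
  have -> : - W / D = W / (- D) by field; lra.
  have -> : U / D = - U / (- D) by field; lra.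
  split; first by apply: pos; lra. split; first by apply: pos; lra.
  have -> : W / - D + - U / - D = (W - U) / (- D) by field; lra.
  by have [] := @div01 (W - U) (- D); lra.
move: (a.1) (b.1) (c.1) (x.1) => u v p q.
case: (RlebP u q) => h1; case: (RlebP v q) => h2; case: (RlebP p q) => h3 //= _ _.
- case: RltbP => hU; case: RltbP => hW //= _ ei.
  + have d : D < 0 by nra.
    by apply: fin' => //; nra.
  + have d : 0 < D by nra.
    by apply: fin => //; nra.
- case: RltbP => hU; case: RltbP => hW //= _ ei.
  + have d : 0 < D by nra.
    by apply: fin => //; nra.
  + have d : D < 0 by nra.
    by apply: fin' => //; nra.
Qed.

Lemma ray_triangle x a b c : ray x a b (+) ray x b c (+) ray x c a -> in_triangle x a b c.
Proof.
have flat u v : Rleb u.1 x.1 = Rleb v.1 x.1 -> ray x u v = false by rewrite /ray => ->; rewrite addbb.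
have K u v w : in_triangle x u v w -> in_triangle x v u w /\ in_triangle x w v u.
  move=> [s [t [m [? ? ? ? ->]]]]; split.
    by exists t, s, m; split=> //; [lra|exact: bary_perm1].
  by exists m, t, s; split=> //; [lra|exact: bary_perm2].
have [ab|ab] := eqVneq (Rleb a.1 x.1) (Rleb b.1 x.1); last first.
- have [ac|ac] := eqVneq (Rleb a.1 x.1) (Rleb c.1 x.1).
  + rewrite (flat c a) ?addbF // (ray_sym x a) => /ray_triangle_aux H.
    by apply: (K _ _ _ (H _ _)).1; rewrite -?ac eq_sym.
  + rewrite (flat b c) ?addbF; last by move: ab ac; do 3!case: Rleb.
    by rewrite (ray_sym x c) => /ray_triangle_aux; apply.
- have [ac|ac] := eqVneq (Rleb a.1 x.1) (Rleb c.1 x.1).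
  + by rewrite !flat // -?ab.
  + rewrite (flat a b) // addFb (ray_sym x b) addbC => /ray_triangle_aux H.
    by apply: (K _ _ _ (K _ _ _ (H _ _)).2).1; rewrite -?ab eq_sym.
Qed.

Fixpoint rays x (l : seq (R * R)) : bool :=
  if l is a :: l' then (if l' is b :: _ then ray x a b else false) (+) rays x l' else false.

Lemma rays_cons x a b l : rays x (a :: b :: l) = ray x a b (+) rays x (b :: l).
Proof. by []. Qed.

Lemma rays_rcons x l a b : rays x (rcons (rcons l a) b) = rays x (rcons l a) (+) ray x a b.
Proof.
elim: l => [|c l IH]; first by rewrite /= ?addbF ?addFb.
rewrite !rcons_cons; case: l IH => [|d l] IH; first by rewrite /= ?addbF ?addbA.
by rewrite !rcons_cons !rays_cons -!rcons_cons IH addbA.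
Qed.

(** Summing [ray_move] over the segments telescopes to the two ends of the line. *)
Lemma rays_move x y a l :
  (forall i, (i < size l)%N -> ~ meets (nth a (a :: l) i) (nth a l i) x y) ->
  rays x (a :: l) (+) rays y (a :: l) = strip x y a (+) strip x y (last a l).
Proof.
elim: l a => [|b l IH] a H; first by rewrite /= addbb.
rewrite !rays_cons addbACA ray_move; last exact: (H 0%N).
rewrite IH; first by rewrite /= addbA addbK.
move=> i il; have := H i.+1 il; rewrite /= !(set_nth_default b a) //=.
by move: il; clear; case: i => //= i il; exact: ltnW.
Qed.
End Plane.

(** * Guarding closed curves *)

Section TriangleBounds.
Local Open Scope R_scope.
Lemma in_triangle_le x a b c v M : in_triangle x a b c ->
  dist2 a v <= M -> dist2 b v <= M -> dist2 c v <= M -> dist2 x v <= M.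
Proof.
move=> [s [t [w [s0 t0 w0 e ->]]]] ha hb hc; apply: Rle_trans (dist2_bary _ _ _ _ s0 t0 w0 e) _.
have -> : M = s * M + t * M + w * M by rewrite -!Rmult_plus_distr_r e; ring.
by have := Rmult_le_compat_l _ _ _ s0 ha; have := Rmult_le_compat_l _ _ _ t0 hb;
   have := Rmult_le_compat_l _ _ _ w0 hc; lra.
Qed.

(** Replacing [c] by [b] in the barycentric combination moves [x] by at most [k], to a point [m] of
    [[a, b]], where [am = ab - bm]. In use, [b] is a node and [a] its almost nearest vertex. *)
Lemma thin_triangle x a b c k d : in_triangle x a b c -> dist2 b c <= k -> dist2 a b <= dist2 x b + d ->
  dist2 x a <= d + 2 * k.
Proof.
move=> [s [t [w [s0 t0 w0 e ->]]]] bc ab.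
pose m := bary a s b (t + w) b 0.
have xm : dist2 (bary a s b t c w) m <= k.
  rewrite dist2E; have -> : comb (bary a s b t c w) 1 m (-1) = comb (comb c 1 b (-1)) w b 0.
    by rewrite /m /bary /comb /=; congr (_, _); ring.
  have := @norm_comb (comb c 1 b (-1)) w b 0 w0 (Rle_refl _).
  by rewrite -dist2E dist2_sym; have := dist2_ge0 b c; nra.
have mE : m = lerp a b (t + w).
  have es : s = 1 - (t + w) by lra.
  by rewrite /m es /bary /lerp /comb /=; congr (_, _); ring.
have am : dist2 a m = (t + w) * dist2 a b by rewrite mE dist2_lerp_l //; lra.
have bm : dist2 b m = (1 - (t + w)) * dist2 a b by rewrite mE dist2_lerp_r //; lra.
have := dist2_tri (bary a s b t c w) m b; have := dist2_tri (bary a s b t c w) m a.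
rewrite (dist2_sym m b) (dist2_sym m a) am bm.
move: xm ab; move: (dist2 _ m) (dist2 _ b) (dist2 _ a) (dist2 a b) => *; lra.
Qed.
End TriangleBounds.

Section Guard.
Local Open Scope R_scope.
Variables (V : finType) (e : rel V) (pos : V -> R * R) (r gap : R) (o : V).
Notation step := (step e).
Notation d2 u v := (dist2 (pos u) (pos v)).
Hypothesis sym_e : symmetric e.
Hypothesis stepP : forall u v, reflect (d2 u v <= r) (step u v).
Hypotheses (r0 : 0 < r) (gap0 : 0 < gap).
Hypothesis gapP : forall u v, d2 u v <= r + gap -> d2 u v <= r.
Hypothesis conn : forall v, connect e o v.

Notation geodesic := (geodesic conn).
Notation legal := (legal conn).
Notation safe := (safe conn).

(** All errors of the approximation by a grid are absorbed here. *)
Lemma step_gap u v : d2 u v <= r + gap -> step u v.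
Proof. by move=> /gapP ?; apply/stepP. Qed.

Lemma geodesicE P : geodesic P -> exists Q v, P = rcons Q v.
Proof. by case/lastP: P => [[]//|Q v _]; exists Q, v. Qed.

Lemma geodesic_last_step Q v : geodesic (rcons Q v) -> (0 < size Q)%N -> step (last o Q) v.
Proof.
move=> [_ _ st] Q0; have := st (size Q).-1; rewrite size_rcons (prednK Q0) ltnSn => /(_ isT).
by rewrite !nth_rcons ltnn eqxx ltn_predL Q0 nth_last.
Qed.

Lemma lev_last P : geodesic P -> lev conn (last o P) = (size P).-1.
Proof. by case=> P0 lP _; rewrite -nth_last lP // ltn_predL. Qed.

Lemma geodesic_rcons P v : geodesic P -> step (last o P) v -> lev conn v = size P -> geodesic (rcons P v).
Proof.
move=> [P0 lP st] sv lv; split; first by rewrite size_rcons.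
- move=> i; rewrite size_rcons ltnS leq_eqVlt nth_rcons => /orP[/eqP ->|iP]; last by rewrite iP lP.
  by rewrite ltnn eqxx.
- move=> i; rewrite size_rcons ltnS => iP; rewrite !nth_rcons iP.
  case: ltnP => [|iP']; first exact: st.
  have -> : i.+1 == size P by lia.
  by move: sv; rewrite -nth_last; have -> : (size P).-1 = i by lia.
Qed.

Lemma geodesic_belast P v : geodesic (rcons P v) -> (0 < size P)%N -> geodesic P.
Proof.
move=> [_ lP st] P0; split=> // i iP.
  by have := lP i; rewrite size_rcons nth_rcons iP => -> //; lia.
have := st i; rewrite size_rcons !nth_rcons iP (ltn_trans _ iP) //; apply; lia.
Qed.

(** A robber this close to the end of [P] is within a step of it and also, the excess being at most
    [gap], of the previous vertex of [P]. *)
Lemma near_end_illegal P x : geodesic P -> d2 (last o P) x <= gap -> ~ legal P x.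
Proof.
move=> gP; have [Q [v PQ]] := geodesicE gP; subst P; rewrite last_rcons => vx lg.
apply: (legal_rcons sym_e gP lg); first by apply: step_gap; lra.
move=> Q0; apply: step_gap; have /stepP := geodesic_last_step gP Q0.
by have := dist2_tri (pos (last o Q)) (pos v) (pos x); lra.
Qed.

Lemma legal_rcons2 P t a x : geodesic (rcons (rcons P t) a) -> legal (rcons (rcons P t) a) x ->
  step a x -> step t x -> False.
Proof.
move=> gP lg sa st; apply: (legal_rcons sym_e gP lg) => //.
by rewrite last_rcons.
Qed.

Definition near tau P z := geodesic P /\
  forall v, dist2 (pos (last o P)) z <= dist2 (pos v) z + tau.

(** By [meets_sides], either one position of the robber is within a step of both path vertices,
    which legality excludes, or one path vertex is within a step of both positions, which
    [safe_near] excludes. *)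
Lemma path_unmet P x x' i : geodesic P -> (i.+1 < size P)%N -> step x x' -> legal P x -> safe P x x' ->
  ~ meets (pos (nth o P i)) (pos (nth o P i.+1)) (pos x) (pos x').
Proof.
move=> gP iP xx' lg sf; move/meets_sides => /(_ r); case.
- by apply/stepP; case: gP => _ _; apply.
- exact/stepP.
have far := safe_near sym_e gP _ sf; have lg' := safe_legal sym_e xx' sf.
have cons := legal_consecutive sym_e gP iP.
move=> [/stepP ax|/stepP bx'] [/stepP ax'|/stepP bx].
- by have := far i (ltnW iP) ax; rewrite ax'.
- by have := cons _ lg; rewrite ax bx.
- by have := cons _ lg'; rewrite ax' bx'.
- by have := far i.+1 iP bx; rewrite bx'.
Qed.

(** Up to [gap], neither [x] nor [x'] is closer to [m] than the end of [P]. Going through [m], this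
    end is within a step of both. *)
Lemma end_unmet P x x' m t : geodesic P -> step x x' -> safe P x x' -> 0 <= t <= 1 ->
  m = lerp (pos x) (pos x') t ->
  (forall v, dist2 (pos (last o P)) m <= dist2 (pos v) m + gap) -> False.
Proof.
move=> gP /stepP xx' sf [t0 t1] mE H; set u := last o P in H.
have P0 : ((size P).-1 < size P)%N by case: gP => P0 _ _; rewrite ltn_predL.
have := dist2_lerp_l (pos x) (pos x') t0; have := dist2_lerp_r (pos x) (pos x') t1.
rewrite -mE => xm x'm; have hx := H x; have hx' := H x'.
have := dist2_tri (pos u) m (pos x'); have := dist2_tri (pos u) m (pos x).
rewrite (dist2_sym m (pos x')) (dist2_sym m (pos x)) => h1 h2.
have ux : step u x by apply: step_gap; lra.
have ux' : step u x' by apply: step_gap; lra.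
have := safe_near sym_e gP P0 sf; rewrite nth_last -/u ux => /(_ isT).
by rewrite ux'.
Qed.

(** A vertex almost nearest to [z] is almost nearest to every point between itself and [z]. *)
Lemma spoke_unmet tau P z x x' : near tau P z -> tau <= gap -> step x x' -> safe P x x' ->
  ~ meets (pos (last o P)) z (pos x) (pos x').
Proof.
move=> [gP nr] tg xx' sf [s [t [[s0 s1] t01 E]]]; apply: (end_unmet gP xx' sf t01 E) => v.
have := nr v; have := dist2_lerp_l (pos (last o P)) z s0; have := dist2_lerp_r (pos (last o P)) z s1.
move: (lerp _ z s) => m hz hu h; have := dist2_tri (pos v) m z.
by rewrite (dist2_sym m z) hz hu; lra.
Qed.

Lemma link_unmet tau k P z z' x x' : near tau P z -> dist2 z z' <= k -> tau + 2 * k <= gap ->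
  step x x' -> safe P x x' -> ~ meets z z' (pos x) (pos x').
Proof.
move=> [gP nr] zz tg xx' sf [s [t [[s0 s1] t01 E]]]; apply: (end_unmet gP xx' sf t01 E) => v.
have := nr v; have := dist2_lerp_l z z' s0.
move: (lerp _ _ s) => m hz h; have := dist2_tri (pos v) m z; have := dist2_tri (pos (last o P)) z m.
have : s * dist2 z z' <= k by have := dist2_ge0 z z'; nra.
by rewrite (dist2_sym m z) hz; lra.
Qed.

Definition full P z := rcons (map pos P) z.

(* For [l] a polygonal line from [z], whether [x] has odd winding number with respect to the closed curve that
   follows [P], goes on to [z] and along [l], and comes back to the root along [Q]. *)
Definition loop P z Q l x := rays (pos x) (full P z) (+) rays (pos x) (full Q (last z l)) (+) rays (pos x) (z :: l).

Definition phi P z Q z' := loop P z Q [:: z'].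

Lemma full_move tau P z x x' : near tau P z -> tau <= gap -> step x x' -> legal P x -> safe P x x' ->
  rays (pos x) (full P z) (+) rays (pos x') (full P z) =
  strip (pos x) (pos x') (pos o) (+) strip (pos x) (pos x') z.
Proof.
move=> nP tg xx' lg sf; have [gP _] := nP; have [P0 lP _] := gP.
case: P P0 lP gP nP lg sf => [//|v P] _ lP gP nP lg sf; have vo : v = o by exact: lev_eq0 (lP 0%N isT).
subst v; rewrite /full map_cons rcons_cons.
rewrite (@rays_move _ _ (pos o) (rcons (map pos P) z)); first by rewrite last_rcons.
move=> i.
rewrite size_rcons size_map ltnS leq_eqVlt => /orP[/eqP ->|iP].
  rewrite -rcons_cons !nth_rcons /= size_map ltnn ltnSn eqxx.
  have -> : nth (pos o) (pos o :: map pos P) (size P) = pos (last o P).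
    by rewrite -map_cons -[size P]/((size (o :: P)).-1) (nth_map o) // nth_last.
  exact: spoke_unmet nP tg xx' sf.
rewrite -rcons_cons !nth_rcons /= size_map iP (leqW iP) -map_cons (nth_map o) ?(nth_map o) //; last exact: leqW.
exact: (path_unmet gP).
Qed.

(** The pieces form a closed curve, so the contributions of the root, of [z] and of the other end of
    [l] occur twice each and cancel. *)
Lemma protects_loop tau P z Q l : near tau P z -> near tau Q (last z l) -> tau <= gap ->
  (forall x x', step x x' -> safe P x x' ->
     forall i, (i < size l)%N -> ~ meets (nth z (z :: l) i) (nth z l i) (pos x) (pos x')) ->
  protects conn P Q (loop P z Q l).
Proof.
move=> nP nQ tg H x x' xx' lP lQ sP sQ.
have hP := full_move nP tg xx' lP sP; have hQ := full_move nQ tg xx' lQ sQ.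
have hl := rays_move (H x x' xx' sP); rewrite /loop.
move: hP hQ hl; move: (rays _ (full P z)) (rays _ (full P z)) (rays _ (full Q _)) (rays _ (full Q _)) => [] [] [] [].
all: move: (rays _ _) (rays _ _) (strip _ _ _) (strip _ _ _) (strip _ _ _) => [] [] [] [] [] //.
Qed.

Lemma protects_phi tau k P z Q z' : near tau P z -> near tau Q z' -> dist2 z z' <= k ->
  0 <= k -> tau + 2 * k <= gap -> protects conn P Q (phi P z Q z').
Proof.
move=> nP nQ zz k0 tg; apply: (protects_loop (tau := tau)) => //; first by lra.
by move=> x x' xx' sP [] //= _; exact: (link_unmet nP zz tg).
Qed.

Lemma phi_sym P z Q z' x : phi P z Q z' x = phi Q z' P z x.
Proof. by rewrite /phi /loop /= !addbF (ray_sym _ z) (addbC (rays _ (full Q _))). Qed.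

(** * Curves with no uncaught vertex inside, and sums of curves *)

Definition trivial_link P z Q z' := forall x, legal P x -> legal Q x -> phi P z Q z' x = false.

Lemma trivial_link_sym P z Q z' : trivial_link P z Q z' -> trivial_link Q z' P z.
Proof. by move=> H x lQ lP; rewrite phi_sym H. Qed.

Lemma full_rcons P t z x : rays (pos x) (full (rcons P t) z) =
  rays (pos x) (rcons (map pos P) (pos t)) (+) ray (pos x) (pos t) z.
Proof. by rewrite /full map_rcons rays_rcons. Qed.

(** The curve runs along [P] and back, so mod 2 only a triangle on the end of [P] and [z], [z']
    remains. By [thin_triangle] a vertex in it is within [gap] of the end of [P]. *)
Lemma trivial_same tau k P z z' : near tau P z -> dist2 z z' <= k ->
  tau + 2 * k <= gap -> trivial_link P z P z'.
Proof.
move=> [gP nr] zz tg x lg _; have [Q [t PQ]] := geodesicE gP; subst P.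
apply/negbTE/negP; rewrite /phi /loop !full_rcons /= !addbF => H.
have T : in_triangle (pos x) (pos t) z z'.
  apply: ray_triangle; move: H; rewrite (ray_sym _ z' (pos t)).
  by case: (rays _ _); case: (ray _ _ _); case: (ray _ _ _); case: (ray _ _ _).
apply: (near_end_illegal gP _ lg); rewrite last_rcons dist2_sym.
have := nr x; rewrite last_rcons => nx.
by have := thin_triangle T zz nx; lra.
Qed.

(** Without the common part, the curve is the sum mod 2 of the triangles [t a z], [t z z'] and
    [t z' b]. A vertex in one of them is within a step of [t] and of [a] or [b], two consecutive
    vertices of a guarded geodesic. *)
Lemma trivial_ext P t a b z z' : geodesic (rcons (rcons P t) a) -> geodesic (rcons (rcons P t) b) ->
  dist2 (pos t) z <= r + gap -> dist2 (pos t) z' <= r + gap ->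
  dist2 (pos a) z <= r + gap -> dist2 (pos a) z' <= r + gap -> dist2 (pos b) z' <= r + gap ->
  trivial_link (rcons (rcons P t) a) z (rcons (rcons P t) b) z'.
Proof.
move=> ga gb tz tz' az az' bz' x la lb.
have ta : d2 t a <= r.
  by apply/stepP; have := geodesic_last_step ga; rewrite last_rcons size_rcons => /(_ isT).
have tb : d2 t b <= r.
  by apply/stepP; have := geodesic_last_step gb; rewrite last_rcons size_rcons => /(_ isT).
apply/negbTE/negP; rewrite /phi /loop !full_rcons /= !addbF => H.
have Ka : d2 x t <= r + gap -> d2 x a <= r + gap -> False.
  by move=> xt xa; apply: (legal_rcons2 ga la); apply: step_gap; rewrite dist2_sym.
have Kb : d2 x t <= r + gap -> d2 x b <= r + gap -> False.
  by move=> xt xb; apply: (legal_rcons2 gb lb); apply: step_gap; rewrite dist2_sym.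
have tt := dist2_refl (pos t); have aa := dist2_refl (pos a); have bb := dist2_refl (pos b).
have [T|[T|T]] : in_triangle (pos x) (pos t) (pos a) z \/ in_triangle (pos x) (pos t) z z' \/
    in_triangle (pos x) (pos t) z' (pos b).
- have [h1|h1] := boolP (ray (pos x) (pos t) (pos a) (+) ray (pos x) (pos a) z (+) ray (pos x) z (pos t)).
    by left; exact: ray_triangle.
  have [h2|h2] := boolP (ray (pos x) (pos t) z (+) ray (pos x) z z' (+) ray (pos x) z' (pos t)).
    by right; left; exact: ray_triangle.
  right; right; apply: ray_triangle; move: h1 h2 H.
  rewrite (ray_sym _ z (pos t)) (ray_sym _ z' (pos t)) (ray_sym _ z' (pos b)) (ray_sym _ (pos b) (pos t)).
  move: (ray _ _ z') (ray _ _ _) (ray _ _ _) (ray _ _ _) (ray _ _ _) (ray _ _ _) (ray _ _ _) (rays _ _).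
  by do 8!case.
- apply: Ka; apply: (in_triangle_le T); rewrite ?tt ?aa ?(dist2_sym z) ?(dist2_sym (pos a) (pos t)); lra.
- apply: Ka; apply: (in_triangle_le T); rewrite ?tt ?aa ?(dist2_sym z) ?(dist2_sym z'); lra.
- apply: Kb; apply: (in_triangle_le T); rewrite ?tt ?bb ?(dist2_sym z') ?(dist2_sym (pos b) (pos t)); lra.
Qed.

Lemma trivial_child P t a z z' : geodesic (rcons (rcons P t) a) ->
  dist2 (pos t) z <= r + gap -> dist2 (pos t) z' <= r + gap ->
  dist2 (pos a) z <= r + gap -> dist2 (pos a) z' <= r + gap ->
  trivial_link (rcons (rcons P t) a) z (rcons P t) z'.
Proof.
move=> ga tz tz' az az' x la _.
have ta : d2 t a <= r.
  by apply/stepP; have := geodesic_last_step ga; rewrite last_rcons size_rcons => /(_ isT).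
apply/negbTE/negP; rewrite /phi /loop !full_rcons /= !addbF => H.
have Ka : d2 x t <= r + gap -> d2 x a <= r + gap -> False.
  by move=> xt xa; apply: (legal_rcons2 ga la); apply: step_gap; rewrite dist2_sym.
have tt := dist2_refl (pos t); have aa := dist2_refl (pos a).
have [T|T] : in_triangle (pos x) (pos t) (pos a) z \/ in_triangle (pos x) (pos t) z z'.
- have [h1|h1] := boolP (ray (pos x) (pos t) (pos a) (+) ray (pos x) (pos a) z (+) ray (pos x) z (pos t)).
    by left; exact: ray_triangle.
  right; apply: ray_triangle; move: h1 H; rewrite (ray_sym _ z (pos t)) (ray_sym _ z' (pos t)).
  move: (ray _ _ z') (ray _ _ _) (ray _ _ _) (ray _ _ _) (ray _ _ _) (rays _ _).
  by do 6!case.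
- apply: Ka; apply: (in_triangle_le T); rewrite ?tt ?aa ?(dist2_sym z) ?(dist2_sym (pos a) (pos t)); lra.
- apply: Ka; apply: (in_triangle_le T); rewrite ?tt ?aa ?(dist2_sym z) ?(dist2_sym z'); lra.
Qed.

Notation cops_beat := (cops_beat conn).

Lemma cops_beat_trivial P z Q z' : trivial_link P z Q z' -> cops_beat P Q (phi P z Q z').
Proof. by move=> H s1 s2 F x _ _ _ _ _ lP lQ; rewrite H. Qed.

Lemma cops_beat_phi_sym P z Q z' : cops_beat P Q (phi P z Q z') -> cops_beat Q P (phi Q z' P z).
Proof.
by move/cops_beat_sym => H s1 s2 F x *; apply: (H s1 s2) => //; rewrite phi_sym.
Qed.

(** Mod 2 the curve is the sum of the other two and of the triangle [z y z'], which is so small that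
    a robber in it is within [gap] of the end of [P]. *)
Lemma cops_beat_triangle tau k P z S y Q z' : near tau P z -> near tau S y -> near tau Q z' ->
  0 <= k -> tau + 2 * k <= gap -> dist2 z z' <= k -> dist2 z y <= k ->
  cops_beat P S (phi P z S y) -> cops_beat S Q (phi S y Q z') -> cops_beat P Q (phi P z Q z').
Proof.
move=> nP nS nQ k0 tg zz zy H1 H2.
apply: (cops_beat_split sym_e _ _ _ _ H1 H2); try by [case: nP|case: nS|case: nQ].
  exact: (protects_phi nP nQ zz).
move=> x lP lS lQ; rewrite /phi /loop /= !addbF => H; apply/negPn/negP; rewrite negb_or => /andP[h1 h2].
have T : in_triangle (pos x) z y z'.
  apply: ray_triangle; move: H h1 h2; rewrite (ray_sym _ z' z).
  by case: (rays _ _); case: (rays _ _); case: (rays _ _); case: (ray _ _ _); case: (ray _ _ _); case: (ray _ _ _).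
apply: (near_end_illegal (proj1 nP) _ lP).
have xz : dist2 (pos x) z <= k.
  by apply: (in_triangle_le T); rewrite ?dist2_refl // dist2_sym.
have := proj2 nP x; have := dist2_tri (pos (last o P)) z (pos x); rewrite (dist2_sym z); lra.
Qed.

Lemma cops_beat_extend tau P z S l Q z' : near tau P z -> near tau S (last z l) -> near tau Q z' ->
  tau <= gap ->
  (forall x x', step x x' ->
     forall i, (i < size (rcons l z'))%N ->
       ~ meets (nth z (z :: rcons l z') i) (nth z (rcons l z') i) (pos x) (pos x')) ->
  cops_beat P S (loop P z S l) -> cops_beat S Q (phi S (last z l) Q z') ->
  cops_beat P Q (loop P z Q (rcons l z')).
Proof.
move=> nP nS nQ tg H H1 H2.
apply: (cops_beat_split sym_e _ _ _ _ H1 H2); try by [case: nP|case: nS|case: nQ].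
  by apply: (protects_loop nP _ tg); [rewrite last_rcons|move=> *; exact: H].
move=> x _ _ _; rewrite /loop /phi /loop last_rcons -rcons_cons.
case/lastP: l {H H1 H2 nS} => [|l w].
  by move=> /=; rewrite !addbF; case: (rays _ _); case: (rays _ _); case: (ray _ _ _); case: (rays _ _).
rewrite -!rcons_cons rays_rcons last_rcons [rays _ [:: w; z']]/= !addbF.
by do 3!case: (rays _ (full _ _)); case: (rays _ _); case: (ray _ _ _).
Qed.

(** * Labelling a fine grid *)

Section Grid.
Variables (N : nat) (A B eta : R).
Hypothesis eta0 : 0 < eta.
Notation node := ('I_N.+1 * 'I_N.+1)%type.
Notation edge := ('I_N * 'I_N.+1 + 'I_N.+1 * 'I_N)%type.

Definition pt (z : node) : R * R := (A + INR z.1 * eta, B + INR z.2 * eta).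
Definition in_box (p : R * R) :=
  (A <= p.1 < A + INR N * eta) /\ (B <= p.2 < B + INR N * eta).
Definition adjacent (u v : node) := [exists d, joins d u v].

Definition flr (u : R) : nat := Z.to_nat (Int_part u).

Lemma flrP u : 0 <= u -> INR (flr u) <= u < INR (flr u) + 1.
Proof.
move=> u0; have [h1 h2] := base_Int_part u.
have z0 : (0 <= Int_part u)%Z.
  have : IZR (-1) < IZR (Int_part u) by lra.
  by move/lt_IZR; lia.
rewrite /flr INR_IZR_INZ Z2Nat.id //; lra.
Qed.

Lemma INR_lt_le a b : INR a < INR b + 1 -> (a <= b)%N.
Proof. by rewrite -S_INR => /INR_lt; lia. Qed.

Lemma flr_close u v : 0 <= u -> 0 <= v -> - 1 <= u - v <= 1 ->
  flr u = flr v \/ flr u = (flr v).+1 \/ flr v = (flr u).+1.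
Proof.
move=> /flrP hu /flrP hv uv.
have h1 : (flr u <= (flr v).+1)%N by apply: INR_lt_le; rewrite S_INR; lra.
have h2 : (flr v <= (flr u).+1)%N by apply: INR_lt_le; rewrite S_INR; lra.
lia.
Qed.

Lemma flr_INR i : flr (INR i) = i.
Proof.
have h := flrP (pos_INR i).
by apply/eqP; rewrite eqn_leq; apply/andP; split; apply: INR_lt_le; lra.
Qed.

Definition snap (p : R * R) : node := (inord (flr ((p.1 - A) / eta)), inord (flr ((p.2 - B) / eta))).

Lemma scaled a u : a <= u < a + INR N * eta -> 0 <= (u - a) / eta < INR N.
Proof.
move=> h; have i0 := Rinv_0_lt_compat _ eta0; split.
  by apply: Rmult_le_pos; lra.
apply: (Rmult_lt_reg_r eta) => //; rewrite /Rdiv Rmult_assoc Rinv_l; lra.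
Qed.

Lemma flr_box a u : a <= u < a + INR N * eta -> (flr ((u - a) / eta) <= N)%N.
Proof. by move=> h; have [h1 h2] := scaled h; have := flrP h1 => ?; apply: INR_lt_le; lra. Qed.

Lemma inord_flr a u : a <= u < a + INR N * eta ->
  a + INR (inord (flr ((u - a) / eta)) : 'I_N.+1) * eta <= u <
  a + INR (inord (flr ((u - a) / eta)) : 'I_N.+1) * eta + eta.
Proof.
move=> h; rewrite inordK ?ltnS ?flr_box //; have [h1 _] := scaled h; have := flrP h1.
have : (u - a) / eta * eta = u - a by field; lra.
move: ((u - a) / eta) (INR _) => x i xe; nra.
Qed.

Lemma snap_pt z : snap (pt z) = z.
Proof.
case: z => i j; rewrite /snap /pt /=.
have -> : (A + INR i * eta - A) / eta = INR i by field; lra.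
have -> : (B + INR j * eta - B) / eta = INR j by field; lra.
by rewrite !flr_INR !inord_val.
Qed.

Lemma dist2_coord p q k : - k <= p.1 - q.1 <= k -> - k <= p.2 - q.2 <= k -> dist2 p q <= 2 * k.
Proof.
move=> h1 h2; rewrite dist2E; set v := comb _ _ _ _.
have := norm_sq v; have := norm_ge0 v.
have e1 : v.1 = p.1 - q.1 by rewrite /v /=; ring.
have e2 : v.2 = p.2 - q.2 by rewrite /v /=; ring.
rewrite e1 e2; move: (norm v) (p.1 - q.1) (p.2 - q.2) h1 h2 => m x y; nra.
Qed.

Lemma adjacent_sym u v : adjacent u v = adjacent v u.
Proof. by apply: eq_existsb => d; rewrite /joins orbC. Qed.

Lemma adjacent_h (i j k : 'I_N.+1) : j = i.+1 :> nat -> adjacent (i, k) (j, k).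
Proof.
move=> ji; have iN : (i < N)%N by have := ltn_ord j; lia.
apply/existsP; exists (inl (Ordinal iN, k)); apply/orP; left.
rewrite /= !xpair_eqE !eqxx /= !andbT -!val_eqE /= /bump; apply/andP; split => //; lia.
Qed.

Lemma adjacent_v (i j k : 'I_N.+1) : j = i.+1 :> nat -> adjacent (k, i) (k, j).
Proof.
move=> ji; have iN : (i < N)%N by have := ltn_ord j; lia.
apply/existsP; exists (inr (k, Ordinal iN)); apply/orP; left.
rewrite /= !xpair_eqE !eqxx /= -!val_eqE /= /bump; apply/andP; split => //; lia.
Qed.

Lemma joins_dist d u v : joins d u v -> dist2 (pt u) (pt v) <= 2 * eta.
Proof.
have H : dist2 (pt (end1 d)) (pt (end2 d)) <= 2 * eta.
  have l (i : 'I_N) : INR (lift ord0 i : 'I_N.+1) = INR (@nat_of_ord N i) + 1 by rewrite lift0 S_INR.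
  by apply: dist2_coord; case: d => [] [i j]; rewrite /pt /end1 /end2 /fst /snd ?l ?[nat_of_ord (widen_ord _ _)]/=; lra.
by case/orP=> /andP[/eqP <- /eqP <-] //; rewrite dist2_sym.
Qed.

Lemma adjacent_dist u v : adjacent u v -> dist2 (pt u) (pt v) <= 2 * eta.
Proof. by case/existsP=> d; exact: joins_dist. Qed.

Lemma in_box_lerp p q s : in_box p -> in_box q -> 0 <= s <= 1 -> in_box (lerp p q s).
Proof.
have c a b u v : a <= u < b -> a <= v < b -> 0 <= s <= 1 -> a <= (1 - s) * u + s * v < b.
  move=> [au ub] [av vb] [s0 s1]; split; first by nra.
  have [s12|s12] := Rle_dec s (1 / 2); nra.
by move=> [p1 p2] [q1 q2] s01; split; exact: c.
Qed.

(* A walk in the grid that follows the segment [p, q] closely: from any of its nodes to a later one and on to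
   [q] is almost a straight way. *)
Lemma discrete_segment p q : in_box p -> in_box q -> exists K (zf : nat -> node),
  [/\ zf 0%N = snap p, zf K = snap q,
      forall j, (j < K)%N -> zf j = zf j.+1 \/ adjacent (zf j) (zf j.+1),
      forall j k, (j <= k <= K)%N ->
        dist2 (pt (zf j)) (pt (zf k)) + dist2 (pt (zf k)) q <= dist2 (pt (zf j)) q + 16 * eta
    & forall j, (j <= K)%N -> dist2 p (pt (zf j)) + dist2 (pt (zf j)) q <= dist2 p q + 16 * eta].
Proof.
move=> bp bq.
have [M [M0 M1]] : exists M : nat, (0 < M)%N /\
   (forall i : bool, - eta <= ((if i then q.1 - p.1 else q.2 - p.2)) / INR M <= eta).
  pose m := (Rabs (q.1 - p.1) + Rabs (q.2 - p.2)) / eta + 1.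
  have m1 : 1 <= m.
    have : 0 <= (Rabs (q.1 - p.1) + Rabs (q.2 - p.2)) / eta; last by rewrite /m; lra.
    apply: Rmult_le_pos; last exact: Rlt_le (Rinv_0_lt_compat _ eta0).
    by have := Rabs_pos (q.1 - p.1); have := Rabs_pos (q.2 - p.2); lra.
  have [h1 h2] := flrP (Rle_trans _ _ _ Rle_0_1 m1).
  exists (flr m).+1; split => // i; rewrite S_INR.
  set M := INR (flr m) + 1 in h2 *.
  have Mp : 0 < M by have := pos_INR (flr m); rewrite /M; lra.
  have bnd : Rabs (if i then q.1 - p.1 else q.2 - p.2) <= M * eta.
    have e1 : (m - 1) * eta = Rabs (q.1 - p.1) + Rabs (q.2 - p.2) by rewrite /m; field; lra.
    have := Rabs_pos (q.1 - p.1); have := Rabs_pos (q.2 - p.2).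
    by case: i; nra.
  have {bnd} [b1 b2] : - (M * eta) <= (if i then q.1 - p.1 else q.2 - p.2) <= M * eta.
    by move: bnd; rewrite /Rabs; case: Rcase_abs => ? ?; lra.
  by split; apply: (Rmult_le_reg_r M) => //; rewrite /Rdiv Rmult_assoc Rinv_l; lra.
have MR : 0 < INR M by apply: lt_0_INR; lia.
have iM := Rinv_0_lt_compat _ MR.
pose par (s : nat) := INR s / INR M; pose m s := lerp p q (par s).
have par01 s : (s <= M)%N -> 0 <= par s <= 1.
  move=> sM; apply: div01 => //; split; first exact: pos_INR.
  by apply: le_INR; lia.
have parM s t : (s <= t)%N -> par s <= par t.
  by move=> st; apply: Rmult_le_compat_r; [exact: Rlt_le|apply: le_INR; lia].
have mbox s : (s <= M)%N -> in_box (m s) by move=> sM; apply: in_box_lerp => //; exact: par01.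
have mS s : - eta <= (m s.+1).1 - (m s).1 <= eta /\ - eta <= (m s.+1).2 - (m s).2 <= eta.
  have e1 : (m s.+1).1 - (m s).1 = (q.1 - p.1) / INR M by rewrite /m /par S_INR /lerp /comb /fst /snd; field; lra.
  have e2 : (m s.+1).2 - (m s).2 = (q.2 - p.2) / INR M by rewrite /m /par S_INR /lerp /comb /fst /snd; field; lra.
  by rewrite e1 e2; split; [exact: (M1 true)|exact: (M1 false)].
pose fx s := inord (flr (((m s).1 - A) / eta)) : 'I_N.+1.
pose fy s := inord (flr (((m s).2 - B) / eta)) : 'I_N.+1.
(* The vertical coordinate is updated on reaching odd times and the horizontal one on reaching even
   times, so that consecutive nodes never differ diagonally. *)
pose zf j : node := (fx j./2, fy (uphalf j)).
have halfM j : (j <= M.*2)%N -> (j./2 <= M)%N by lia.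
have uphalfM j : (j <= M.*2)%N -> (uphalf j <= M)%N by lia.
have close j : (j <= M.*2)%N -> dist2 (pt (zf j)) (m j./2) <= 4 * eta.
  move=> jM; have -> : 4 * eta = 2 * (2 * eta) by ring.
  have [[x1 x2] _] := mbox _ (halfM _ jM); have [_ [y1 y2]] := mbox _ (uphalfM _ jM).
  have hx := inord_flr (conj x1 x2); have hy := inord_flr (conj y1 y2).
  have px : (pt (zf j)).1 = A + INR (fx j./2) * eta by [].
  have py : (pt (zf j)).2 = B + INR (fy (uphalf j)) * eta by [].
  apply: dist2_coord; first by rewrite px /fx; lra.
  rewrite py.
  have [eu|eu] : uphalf j = j./2 \/ uphalf j = j./2.+1 by lia.
    by rewrite -eu /fy; lra.
  have [_ my] := mS j./2; rewrite -eu in my; rewrite /fy; lra.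
have stepx s : (s < M)%N -> fx s = fx s.+1 \/ fx s.+1 = (fx s).+1 :> nat \/ fx s = (fx s.+1).+1 :> nat.
  move=> sM; have [h1 _] := mbox s (ltnW sM); have [h2 _] := mbox s.+1 sM.
  rewrite /fx !inordK ?ltnS ?flr_box //.
  have := @flr_close (((m s).1 - A) / eta) (((m s.+1).1 - A) / eta) (proj1 (scaled h1)) (proj1 (scaled h2)).
  case=> [|->|[->|->]]; auto.
  have [mx _] := mS s.
  have -> : ((m s).1 - A) / eta - ((m s.+1).1 - A) / eta = - (((m s.+1).1 - (m s).1) / eta) by field; lra.
  have ie := Rinv_0_lt_compat _ eta0.
  have [d1 d2] : -1 <= ((m s.+1).1 - (m s).1) / eta <= 1; last by lra.
  by split; apply: (Rmult_le_reg_r eta) => //; rewrite /Rdiv Rmult_assoc Rinv_l; lra.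
have stepy s : (s < M)%N -> fy s = fy s.+1 \/ fy s.+1 = (fy s).+1 :> nat \/ fy s = (fy s.+1).+1 :> nat.
  move=> sM; have [_ h1] := mbox s (ltnW sM); have [_ h2] := mbox s.+1 sM.
  rewrite /fy !inordK ?ltnS ?flr_box //.
  have := @flr_close (((m s).2 - B) / eta) (((m s.+1).2 - B) / eta) (proj1 (scaled h1)) (proj1 (scaled h2)).
  case=> [|->|[->|->]]; auto.
  have [_ my] := mS s.
  have -> : ((m s).2 - B) / eta - ((m s.+1).2 - B) / eta = - (((m s.+1).2 - (m s).2) / eta) by field; lra.
  have ie := Rinv_0_lt_compat _ eta0.
  have [d1 d2] : -1 <= ((m s.+1).2 - (m s).2) / eta <= 1; last by lra.
  by split; apply: (Rmult_le_reg_r eta) => //; rewrite /Rdiv Rmult_assoc Rinv_l; lra.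
have m0 : m 0%N = p by rewrite /m /par /lerp /comb [RHS]surjective_pairing; congr (_, _); rewrite /=; field; lra.
have mM : m M = q by rewrite /m /par /lerp /comb [RHS]surjective_pairing; congr (_, _); field; lra.
exists M.*2, zf; split.
- by rewrite /zf /snap /fx /fy [0./2]/= [uphalf 0]/= m0.
- by rewrite /zf /snap /fx /fy doubleK uphalf_double mM.
- move=> j jM; rewrite /zf; have [odd_j|even_j] := boolP (odd j).
    have -> : uphalf j.+1 = uphalf j by lia.
    have -> : j.+1./2 = (j./2).+1 by lia.
    have jj : (j./2 < M)%N by lia.
    case: (stepx _ jj) => [->|[h|h]]; first by left.
      by right; exact: adjacent_h.
    by right; rewrite adjacent_sym; exact: adjacent_h.
  have -> : j.+1./2 = j./2 by lia.
  have -> : uphalf j.+1 = (uphalf j).+1 by lia.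
  have jj : (uphalf j < M)%N by lia.
  case: (stepy _ jj) => [->|[h|h]]; first by left.
    by right; exact: adjacent_v.
  by right; rewrite adjacent_sym; exact: adjacent_v.
- move=> j k /andP[jk kM]; have jM := leq_trans jk kM.
  have := close j jM; have := close k kM.
  have e1 : dist2 (m j./2) (m k./2) + dist2 (m k./2) q <= dist2 (m j./2) q.
    have pjk : par j./2 <= par k./2 by apply: parM; lia.
    have [pj0 pj1] := par01 _ (halfM _ jM); have [pk0 pk1] := par01 _ (halfM _ kM).
    rewrite !(dist2_sym _ q) !dist2_lerp_r //.
    suff : dist2 (m j./2) (m k./2) <= (par k./2 - par j./2) * dist2 p q by lra.
    rewrite !dist2E; set h := _ - _; have h0 : 0 <= h by rewrite /h; lra.
    have -> : comb (m j./2) 1 (m k./2) (-1) = comb (comb p 1 q (-1)) h p 0.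
      by rewrite /m /lerp /comb /h /=; congr (_, _); ring.
    by have := @norm_comb (comb p 1 q (-1)) h p 0 h0 (Rle_refl _); lra.
  have := dist2_tri (pt (zf j)) (m j./2) (pt (zf k)); have := dist2_tri (m j./2) (m k./2) (pt (zf k)).
  have := dist2_tri (pt (zf k)) (m k./2) q; have := dist2_tri (m j./2) (pt (zf j)) q.
  rewrite (dist2_sym (m k./2) (pt _)) (dist2_sym (m j./2) (pt _)); lra.
- move=> j jM; have := close j jM; have [p0 p1] := par01 _ (halfM _ jM).
  have := dist2_lerp_l p q p0; have := dist2_lerp_r p q p1; rewrite -/(m j./2).
  have := dist2_tri p (m j./2) (pt (zf j)); have := dist2_tri (pt (zf j)) (m j./2) q.
  rewrite (dist2_sym (m j./2) (pt _)) (dist2_sym q (m _)); lra.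
Qed.

(** * Labels of the nodes and their propagation along walks *)

Section Labels.
Variable root : node.
Implicit Types (lab : node -> seq V).

Definition linked lab (u v : node) := [/\ adjacent u v, lab u <> [::], lab v <> [::] &
  trivial_link (lab u) (pt u) (lab v) (pt v)].

(* Unlabelled nodes have the label [::]. *)
Inductive reached lab : node -> Prop :=
| reached_root : lab root <> [::] -> reached lab root
| reached_link u v : reached lab u -> linked lab v u -> reached lab v.

Definition connected_labels lab := forall z, lab z <> [::] -> reached lab z.
Definition extends lab lab' := forall z, lab z <> [::] -> lab' z = lab z.

Lemma reached_extends lab lab' z : extends lab lab' -> reached lab z -> reached lab' z.
Proof.
move=> ext; elim=> [r1|u v _ IH [adj lv lu tr]]; first by apply: reached_root; rewrite ext.
by apply: reached_link IH _; split; rewrite ?ext.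
Qed.

(** New labels depend on the node and not on the time, since a walk may visit a node repeatedly. *)
Definition add_labels lab (zf : nat -> node) k (L : node -> seq V) : node -> seq V :=
  fun z => if lab z is [::] then (if [exists j : 'I_k, zf j == z] then L z else [::]) else lab z.

Lemma add_labels_extends lab zf k L : extends lab (add_labels lab zf k L).
Proof. by move=> z; rewrite /add_labels; case: (lab z). Qed.

Lemma add_labels_new lab zf k L j : (j < k)%N -> lab (zf j) = [::] -> add_labels lab zf k L (zf j) = L (zf j).
Proof.
move=> jk l0; rewrite /add_labels l0; case: existsP => // H.
by case: H; exists (Ordinal jk) => /=.
Qed.

Lemma add_labelsP lab zf k L z : add_labels lab zf k L z <> [::] ->
  (lab z <> [::] /\ add_labels lab zf k L z = lab z) \/
  (lab z = [::] /\ exists2 j, (j < k)%N & z = zf j /\ add_labels lab zf k L z = L z).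
Proof.
rewrite /add_labels; case: (lab z) => [|v s] H; last by left.
right; split => //; case: existsP H => // -[j /eqP zj] _.
by exists j => //; case: existsP => // -[]; exists j; rewrite zj.
Qed.

Lemma add_labels_connected lab zf k L : connected_labels lab -> lab (zf k) <> [::] ->
  (forall j, (j < k)%N -> lab (zf j) = [::]) ->
  (forall j, (j < k)%N -> zf j = zf j.+1 \/ adjacent (zf j) (zf j.+1)) ->
  (forall j, (j < k)%N -> L (zf j) <> [::]) ->
  (forall j, (j < k)%N -> adjacent (zf j) (zf j.+1) ->
     trivial_link (L (zf j)) (pt (zf j)) (add_labels lab zf k L (zf j.+1)) (pt (zf j.+1))) ->
  connected_labels (add_labels lab zf k L).
Proof.
move=> cl lk new st Ln tr; have ext := @add_labels_extends lab zf k L.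
set lab' := add_labels _ _ _ _ in ext tr *.
have R i : (i <= k)%N -> reached lab' (zf (k - i)%N).
  elim: i => [|i IH] ik; first by rewrite subn0; apply: reached_extends ext _; exact: cl.
  have jk : (k - i.+1 < k)%N by lia.
  have eS : (k - i.+1).+1 = (k - i)%N by lia.
  have {IH}IH := IH (ltnW ik).
  have := st _ jk; rewrite eS => -[->//|adj]; apply: reached_link IH _.
  have lj : lab' (zf (k - i.+1)%N) = L (zf (k - i.+1)%N) by apply: add_labels_new => //; exact: new.
  split=> //.
  - by rewrite lj; exact: Ln.
  - case: i ik jk eS adj lj => [|i] ik jk eS adj lj; first by rewrite subn0 ext.
    have jk' : (k - i.+1 < k)%N by lia.
    by rewrite /lab' add_labels_new //; [exact: Ln|exact: new].
  - by rewrite lj; have := tr _ jk; rewrite eS; apply.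
move=> z /add_labelsP[[lz _]|[_ [j jk [-> _]]]]; first by apply: reached_extends ext _; exact: cl.
by have := R (k - j)%N; rewrite (subKn (ltnW jk)) leq_subr; apply.
Qed.

Lemma first_labelled lab (zf : nat -> node) K : lab (zf K) <> [::] ->
  exists k, [/\ (k <= K)%N, lab (zf k) <> [::] & forall j, (j < k)%N -> lab (zf j) = [::]].
Proof.
move=> lK; have ex : exists k, lab (zf k) != [::] by exists K; apply/eqP.
case: (ex_minnP ex) => k lk mink; exists k; split; first by apply: mink; apply/eqP.
  exact/eqP.
by move=> j jk; apply/eqP/negPn/negP => /mink; rewrite leqNgt jk.
Qed.

Variable nv : node -> V.
Hypothesis nvP : forall z v, dist2 (pos (nv z)) (pt z) <= dist2 (pos v) (pt z).
Hypothesis boxP : forall v, in_box (pos v).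
Notation rd v := (snap (pos v)).
Notation err := (16 * eta).

Definition near_labels tau lab := forall z, lab z <> [::] -> near tau (lab z) (pt z).

Lemma near_mono tau tau' P z : tau <= tau' -> near tau P z -> near tau' P z.
Proof. by move=> tt [gP nP]; split=> // v; have := nP v; lra. Qed.

Lemma geodesic_neq0 P : geodesic P -> P <> [::].
Proof. by case=> P0 _ _ P1; rewrite P1 in P0. Qed.

(* The nearest vertex of a node need not be reachable from its label, so a new node copies the label that the
   straight way to this vertex runs into. *)
Lemma label_spoke tau lab y : near_labels tau lab -> connected_labels lab ->
  lab (rd (nv y)) <> [::] -> in_box (pt y) -> tau + 3 * err <= gap ->
  exists lab', [/\ near_labels (tau + 2 * err) lab', connected_labels lab', extends lab lab' & lab' y <> [::]].
Proof.
move=> nl cl lq by_ tg; have [K [zf [z0 zK st S1 S2]]] := discrete_segment by_ (boxP (nv y)).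
rewrite -zK in lq; have [k [kK lk new]] := @first_labelled lab zf K lq.
have [gT nT] := nl _ lk.
set q := pos (nv y) in zK S1 S2; set T := lab (zf k) in lk gT nT.
(* At [zf k] the end of [T] is about as close as the nearest vertex of [y]. One [err] is lost
   between [zf j] and [zf k], another between [y] and [zf j]. *)
have nrT j : (j <= k)%N -> near (tau + 2 * err) T (pt (zf j)).
  move=> jk; split=> // v; have jK := leq_trans jk kK.
  have h1 := S1 j k (introT andP (conj jk kK)); have h2 := S2 j jK.
  have h3 := nT (nv y); rewrite -/q in h3.
  have h4 := dist2_tri (pos (last o T)) (pt (zf k)) (pt (zf j)); have h5 := nvP y v.
  have h6 := dist2_tri (pos v) (pt (zf j)) (pt y).
  have s1 := dist2_sym (pt (zf k)) q; have s2 := dist2_sym (pt (zf k)) (pt (zf j)).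
  have s3 := dist2_sym (pt y) q; have s4 := dist2_sym (pt y) (pt (zf j)).
  by rewrite -/q in h5; lra.
exists (add_labels lab zf k (fun=> T)); split.
- move=> z /add_labelsP[[lz ->]|[_ [j jk [-> ->]]]]; last exact: nrT (ltnW jk).
  by apply: near_mono (nl _ lz); lra.
- apply: add_labels_connected => //; first by move=> j jk; apply: st; exact: leq_trans jk kK.
  move=> j jk adj; have -> : add_labels lab zf k (fun=> T) (zf j.+1) = T.
    have [jk'|kj] := ltnP j.+1 k; first by rewrite add_labels_new ?new.
    by have -> : j.+1 = k by [lia]; rewrite add_labels_extends.
  apply: (trivial_same (nrT j (ltnW jk)) (adjacent_dist adj)); lra.
- exact: add_labels_extends.
- have zy : y = zf 0%N by rewrite z0 snap_pt.
  rewrite zy; case: (posnP k) => [k0|kp]; first by rewrite add_labels_extends -k0.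
  by rewrite add_labels_new ?new.
Qed.

(** Unlabelled nodes copy the label of a labelled neighbour. This moves the reference point by at
    most [2 * eta], which costs twice as much in precision. *)
Lemma label_dilate tau lab : near_labels tau lab -> connected_labels lab -> tau + 8 * eta <= gap ->
  exists lab', [/\ near_labels (tau + 4 * eta) lab', connected_labels lab', extends lab lab' &
     forall u v, adjacent u v -> lab v <> [::] -> lab' u <> [::]].
Proof.
move=> nl cl tg.
pose src u := odflt u [pick v | adjacent u v & lab v != [::]].
pose lab' u := if lab u is [::] then lab (src u) else lab u.
have ext : extends lab lab' by move=> u; rewrite /lab'; case: (lab u).
have srcP u : lab u = [::] -> lab' u <> [::] -> [/\ adjacent u (src u), lab (src u) <> [::] & lab' u = lab (src u)].
  move=> lu; rewrite /lab' lu /src; case: pickP => [v /andP[adj /eqP lv]|] //=.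
have nr u : lab' u <> [::] -> near (tau + 4 * eta) (lab' u) (pt u).
  case El : (lab u) => [|v s] lu; last first.
    by rewrite ext ?El // -El; apply: near_mono (nl u _); [lra|rewrite El].
  have [adj lsu ->] := srcP u El lu; have [gT nT] := nl _ lsu; split=> // v.
  have := nT v; have := adjacent_dist adj.
  have := dist2_tri (pos (last o (lab (src u)))) (pt (src u)) (pt u).
  have := dist2_tri (pos v) (pt u) (pt (src u)); rewrite (dist2_sym (pt (src u)) (pt u)); lra.
exists lab'; split=> //.
- move=> u lu; case El : (lab u) => [|v s]; last by apply: (reached_extends ext); apply: cl; rewrite El.
  have [adj lsu eu] := srcP u El lu.
  apply: (reached_link (reached_extends ext (cl _ lsu))); split=> //; first by rewrite ext.
  rewrite (ext (src u)) // -eu; apply: (trivial_same (nr u lu) (adjacent_dist adj)); lra.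
- move=> u v adj lv; case El : (lab u) => [|w s]; last by rewrite ext El.
  rewrite /lab' El /src; case: pickP => [w /andP[_ /eqP]//|/(_ v)].
  by rewrite adj /=; case: eqP => [/lv|].
Qed.

Definition ext_label Q (a b : R * R) X := X = Q \/ exists v, [/\ X = rcons Q v, geodesic X,
  dist2 (pos v) a <= r + gap & dist2 (pos v) b <= r + gap].

Lemma trivial_pair tau Q a b X X' : near tau X a -> dist2 a b <= 2 * eta -> tau + 4 * eta <= gap ->
  Q <> [::] -> dist2 (pos (last o Q)) a <= r + gap -> dist2 (pos (last o Q)) b <= r + gap ->
  ext_label Q a b X -> ext_label Q a b X' -> trivial_link X a X' b.
Proof.
move=> nX ab tg Q0 qa qb; case/lastP: Q Q0 qa qb => [//|P t] _; rewrite last_rcons => ta tb.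
case=> [eX|[v [eX gX va vb]]]; case=> [eX'|[v' [eX' gX' va' vb']]]; subst X X'.
- by apply: (trivial_same nX ab); lra.
- by apply/trivial_link_sym/trivial_child.
- exact: trivial_child.
- exact: trivial_ext.
Qed.

(* Second condition: the last but one vertex of a label of maximal length is almost a nearest vertex of its
   level. *)
Definition strands i tau lab := [/\ near_labels tau lab,
  forall z P t w, lab z = rcons (rcons P t) w -> size P = i ->
    forall s, lev conn s = i -> dist2 (pos t) (pt z) <= dist2 (pos s) (pt z) + tau,
  forall z, (size (lab z) <= i.+2)%N & connected_labels lab].

Lemma between_levels i u t v : lev conn u = i.+1 -> lev conn t = i -> step v u -> step v t ->
  lev conn v = i \/ lev conn v = i.+1.
Proof.
move=> lu lt vu vt; have := lev_step conn vu; rewrite step_sym // in vt; have := lev_step conn vt; lia.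
Qed.

(* A new node on the way from [u] to its nearest vertex [t] of the previous level is labelled by continuing the
   geodesic of the first labelled node on this way.  This geodesic ends within the two levels, and its last
   vertex of level [i] is about as close as [t], hence adjacent to the vertices around the way. *)
Lemma label_strand i tau lab u t : strands i tau lab -> lev conn u = i.+1 -> lev conn t = i ->
  (forall s, lev conn s = i -> d2 u t <= d2 u s) -> lab (rd t) <> [::] -> 0 <= tau -> tau + 6 * err <= gap ->
  exists lab', [/\ strands i (tau + 2 * err) lab', extends lab lab' & lab' (rd u) <> [::]].
Proof.
move=> [nl ty sm cl] lu lt near_t lq tau0 tg.
have ut : d2 u t <= r.
  have [p lp pu] := lev_parent lu; apply: Rle_trans (near_t p lp) _; rewrite dist2_sym.
  by apply/stepP; rewrite /Defs.step pu orbT.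
have [K [zf [z0 zK st S1 S2]]] := discrete_segment (boxP u) (boxP t).
rewrite -zK in lq; have [k [kK lk new]] := @first_labelled lab zf K lq.
have [gT nT] := nl _ lk; set T := lab (zf k) in lk gT nT; set w := last o T in nT.
pose b := pt (zf k); have S2k := S2 k kK; rewrite -/b in nT S2k.
have wu : step w u.
  apply: step_gap; have := nT t; have := dist2_tri (pos w) b (pos u).
  by have := dist2_sym b (pos t); have := dist2_sym b (pos u); lra.
have wt : step w t.
  by apply: step_gap; have := nT u; have := dist2_tri (pos w) b (pos t); lra.
have lw := between_levels lu lt wu wt.
(* [Q] is the part of [T] up to level [i]. If [T] goes one level further, the second condition of
   [strands] bounds the distance of the end of [Q]. *)
have [Q [gQ sQ ts TQ]] : exists Q, [/\ geodesic Q, size Q = i.+1,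
    dist2 (pos (last o Q)) b <= dist2 (pos t) b + tau & T = Q \/ T = rcons Q w].
  have sT : size T = (lev conn w).+1 by rewrite /w (lev_last gT) prednK //; case: gT.
  case: lw => lw; rewrite lw in sT; first by exists T; split=> //; left.
  have [P' [w' eT]] := geodesicE gT.
  have ww : w' = w by rewrite /w eT last_rcons.
  have P0 : (0 < size P')%N by move: sT; rewrite eT size_rcons; lia.
  have gP : geodesic P' by apply: (@geodesic_belast _ w'); rewrite -?eT.
  have [P [s eP]] := geodesicE gP; exists P'; split=> //; last by right; rewrite eT ww.
    by move: sT; rewrite eT size_rcons; lia.
  rewrite eP last_rcons; apply: (ty (zf k) P s w') => //; first by rewrite -eP -eT.
  by move: sT; rewrite eT eP !size_rcons; lia.
set q := last o Q in ts.
have lq' : lev conn q = i by rewrite (lev_last gQ) sQ.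
have Q0 := geodesic_neq0 gQ.
pose a j := pt (zf j).
have far j : (j <= k)%N -> [/\ dist2 (pos t) (a j) + dist2 (pos u) (a j) <= r + err,
   dist2 (pos q) (a j) <= dist2 (pos t) (a j) + err + tau,
   dist2 (pos w) (a j) <= dist2 (pos t) (a j) + err + tau &
   forall s, lev conn s = i -> dist2 (pos t) (a j) <= dist2 (pos s) (a j) + err].
  move=> jk; have jK := leq_trans jk kK.
  have h1 := S1 j k (introT andP (conj jk kK)); have h2 := S2 j jK; rewrite -/b -/(a j) in h1 h2.
  have s1 := dist2_sym (a j) (pos t); have s2 := dist2_sym b (pos t); have s3 := dist2_sym b (a j).
  split; first by lra.
  - by have := dist2_tri (pos q) b (a j); lra.
  - by have := dist2_tri (pos w) b (a j); have := nT t; lra.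
  - move=> s ls; have := near_t s ls; have := dist2_tri (pos s) (a j) (pos u).
    by have := dist2_sym (pos s) (pos u); have := dist2_sym (a j) (pos u); lra.
pose v j := nv (zf j).
have vj j : (j <= k)%N -> [/\ dist2 (pos (v j)) (a j) <= dist2 (pos u) (a j),
   dist2 (pos (v j)) (a j) <= dist2 (pos t) (a j) & lev conn (v j) = i \/ lev conn (v j) = i.+1].
  move=> jk; have [f1 _ _ _] := far j jk; have h1 := nvP (zf j) u; have h2 := nvP (zf j) t.
  rewrite -/(v j) -/(a j) in h1 h2; split=> //; apply: (between_levels lu lt); apply: step_gap.
    by have := dist2_tri (pos (v j)) (a j) (pos u); have := dist2_sym (a j) (pos u); lra.
  by have := dist2_tri (pos (v j)) (a j) (pos t); have := dist2_sym (a j) (pos t); lra.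
(* A nearest vertex of level [i.+1] prolongs [Q]. Otherwise it has level [i], so it is hardly closer
   than [t], hence hardly closer than the end of [T], and [T] is kept. *)
pose L z := if lev conn (nv z) == i.+1 then rcons Q (nv z) else T.
have gL j : (j <= k)%N -> lev conn (v j) = i.+1 -> geodesic (rcons Q (v j)).
  move=> jk lv; apply: geodesic_rcons => //; last by rewrite sQ.
  have [f1 f2 _ _] := far j jk; have [f3 _ _] := vj j jk; apply: step_gap; rewrite -/q.
  by have := dist2_tri (pos q) (a j) (pos (v j)); have := dist2_sym (a j) (pos (v j)); lra.
have nrL j : (j <= k)%N -> near (tau + 2 * err) (L (zf j)) (a j).
  move=> jk; rewrite /L -/(v j); have [f1 f2 f3 f4] := far j jk; have [h1 h2 h3] := vj j jk.
  case: eqP => lv; first by split; [exact: gL|move=> x; rewrite last_rcons; have := nvP (zf j) x; rewrite -/(v j) -/(a j); lra].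
  split=> // x; rewrite -/w; have lvi : lev conn (v j) = i by case: h3.
  by have := f4 _ lvi; have := nvP (zf j) x; rewrite -/(v j) -/(a j); lra.
have extL j c : (j <= k)%N -> dist2 (a j) c <= 2 * eta \/ dist2 c (a j) <= 2 * eta ->
    ext_label Q (a j) c (L (zf j)) /\ ext_label Q (a j) c T.
  move=> jk ac; have {}ac : dist2 (a j) c <= 2 * eta by case: ac; rewrite // dist2_sym.
  have [f1 f2 f3 f4] := far j jk; have [h1 h2 h3] := vj j jk.
  have u0 := dist2_ge0 (pos u) (a j).
  have XT : ext_label Q (a j) c T.
    case: TQ => TQ; [by left|right; exists w; split=> //]; first by lra.
    by have := dist2_tri (pos w) (a j) c; lra.
  split=> //; rewrite /L -/(v j); case: eqP => // lv; right; exists (v j); split; [by []|exact: gL| |].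
    by lra.
  by have := dist2_tri (pos (v j)) (a j) c; lra.
exists (add_labels lab zf k L); split.
- split.
  + move=> z /add_labelsP[[lz ->]|[_ [j jk [-> ->]]]]; last exact: nrL (ltnW jk).
    by apply: near_mono (nl _ lz); lra.
  + move=> z P s x eL sP s' ls'; have ne : add_labels lab zf k L z <> [::] by rewrite eL; case: (P).
    case/add_labelsP: ne => [[lz ez]|[_ [j jk [zj ez]]]].
      by have := ty z P s x; rewrite -ez eL => /(_ erefl sP s' ls'); lra.
    have sq : s = q.
      have : rcons (rcons P s) x = rcons Q (last o (rcons (rcons P s) x)).
        rewrite last_rcons; move: eL; rewrite ez /L; case: eqP => _ => [/rcons_inj[-> _] //|eT].
        case: TQ => TQ; last by move: eT; rewrite TQ => /rcons_inj[-> _].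
        by move: sQ; rewrite -TQ eT !size_rcons sP; lia.
      by move=> /rcons_inj[eQ _]; rewrite /q -eQ last_rcons.
    have [f1 f2 f3 f4] := far j (ltnW jk); rewrite zj sq -/(a j); have := f4 _ ls'; lra.
  + move=> z; case E : (add_labels lab zf k L z) => [//|y s]; rewrite -E.
    have /add_labelsP[[lz ->]|[_ [j jk [_ ->]]]] : add_labels lab zf k L z <> [::] by rewrite E.
      exact: sm.
    by rewrite /L; case: eqP => _; [rewrite size_rcons sQ|exact: sm].
  + apply: add_labels_connected => //.
    * by move=> j jk; apply: st; exact: leq_trans jk kK.
    * by move=> j jk; have [/geodesic_neq0] := nrL j (ltnW jk).
    move=> j jk adj; have ad := adjacent_dist adj; rewrite -/(a j) -/(a j.+1) in ad *.
    have [f1 f2 _ _] := far j (ltnW jk); have [g1 g2 _ _] := far j.+1 jk.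
    have u0 := dist2_ge0 (pos u) (a j); have u1 := dist2_ge0 (pos u) (a j.+1).
    have [e1 eT] := @extL j (a j.+1) (ltnW jk) (or_introl ad).
    have [e2 _] := @extL j.+1 (a j) jk (or_intror ad).
    apply: (trivial_pair (nrL j (ltnW jk)) ad _ Q0) => //; rewrite -/q; try lra.
    have [jk'|kj] := ltnP j.+1 k.
      rewrite add_labels_new ?new //; case: e2 => [|[y [? ? ? ?]]]; [by left|by right; exists y; split].
    have -> : add_labels lab zf k L (zf j.+1) = T; last exact: eT.
    by have -> : j.+1 = k by [lia]; rewrite add_labels_extends.
- exact: add_labels_extends.
- rewrite -z0; case: (posnP k) => [k0|kp]; first by rewrite add_labels_extends -k0.
  rewrite add_labels_new ?new //; have [/geodesic_neq0] := nrL 0%N (leq0n k); exact.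
Qed.

Lemma seq_min (T : eqType) (f : T -> R) (s : seq T) : s <> [::] ->
  exists2 x, x \in s & forall y, y \in s -> f x <= f y.
Proof.
elim: s => [//|a [|b s] IH] _.
  by exists a; rewrite ?inE // => y; rewrite inE => /eqP ->; exact: Rle_refl.
have [//|x xs mx] := IH; case: (Rle_dec (f a) (f x)) => ax.
  exists a; rewrite ?inE ?eqxx // => y; rewrite inE => /orP[/eqP ->|/mx]; lra.
exists x; first by rewrite inE xs orbT.
by move=> y; rewrite inE => /orP[/eqP ->|/mx //]; lra.
Qed.

Lemma snap_close p : in_box p -> dist2 p (pt (snap p)) <= 2 * eta.
Proof.
move=> [h1 h2]; have h3 := inord_flr h1; have h4 := inord_flr h2.
have e1 : (pt (snap p)).1 = A + INR (inord (flr ((p.1 - A) / eta)) : 'I_N.+1) * eta by [].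
have e2 : (pt (snap p)).2 = B + INR (inord (flr ((p.2 - B) / eta)) : 'I_N.+1) * eta by [].
by apply: dist2_coord; rewrite ?e1 ?e2; lra.
Qed.

Lemma near_labels_mono tau tau' lab : tau <= tau' -> near_labels tau lab -> near_labels tau' lab.
Proof. by move=> tt nl z /nl; exact: near_mono. Qed.

Lemma strands_mono i tau tau' lab : tau <= tau' -> strands i tau lab -> strands i tau' lab.
Proof.
move=> tt [nl ty sm cl]; split=> //; first exact: near_labels_mono nl.
by move=> z P t w eL sP s ls; have := ty z P t w eL sP s ls; lra.
Qed.

Lemma strands_next i tau lab : strands i tau lab -> strands i.+1 tau lab.
Proof.
move=> [nl ty sm cl]; split=> // [z P t w eL sP|z].
  by have := sm z; rewrite eL !size_rcons sP; lia.
exact: leq_trans (sm z) (leqnSn _).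
Qed.

Lemma extends_trans lab1 lab2 lab3 : extends lab1 lab2 -> extends lab2 lab3 -> extends lab1 lab3.
Proof. by move=> h1 h2 z lz; rewrite h2 ?h1. Qed.

Lemma label_level i (s : seq V) tau lab : strands i tau lab ->
  (forall v, (lev conn v <= i)%N -> lab (rd v) <> [::]) ->
  0 <= tau -> tau + INR (size s) * (2 * err) + 6 * err <= gap ->
  exists lab', [/\ strands i (tau + INR (size s) * (2 * err)) lab', extends lab lab' &
     forall v, v \in s -> lev conn v = i.+1 -> lab' (rd v) <> [::]].
Proof.
move=> st low tau0; elim: s => [|u s IH] tg.
  by exists lab; split=> //; apply: strands_mono st; rewrite /=; lra.
have sz0 := pos_INR (size s).
have sz : INR (size (u :: s)) = INR (size s) + 1 by rewrite -S_INR.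
rewrite sz in tg *; have [|lab1 [st1 ext1 new1]] := IH; first by nra.
have [lu|lu] := eqVneq (lev conn u) i.+1; last first.
  exists lab1; split=> //; first by apply: strands_mono st1; nra.
  by move=> v; rewrite inE => /orP[/eqP -> lv|]; [rewrite lv eqxx in lu|exact: new1].
have [t' lt' _] := lev_parent lu.
have [|t tl mt] := @seq_min V (fun s => d2 u s) (enum [pred s | lev conn s == i]).
  move=> e0; have : t' \in enum [pred s | lev conn s == i] by rewrite mem_enum inE lt'.
  by rewrite e0.
rewrite mem_enum inE in tl; have {tl}lt := eqP tl.
have near_t s' : lev conn s' = i -> d2 u t <= d2 u s'.
  by move=> ls; apply: mt; rewrite mem_enum inE ls.
have lqt : lab1 (rd t) <> [::] by rewrite ext1; apply: low; rewrite lt.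
have [||lab2 [st2 ext2 new2]] := label_strand st1 lu lt near_t lqt; [nra|nra|].
exists lab2; split; first by apply: strands_mono st2; lra.
  exact: extends_trans ext2.
move=> v; rewrite inE => /orP[/eqP -> //|vs lv]; rewrite ext2; exact: new1.
Qed.

Let nV := size (enum V).

Lemma label_levels i : root = rd o -> err + INR i * (INR nV * (2 * err)) + 6 * err <= gap ->
  exists lab, strands i (err + INR i * (INR nV * (2 * err))) lab /\
    forall v, (lev conn v <= i)%N -> lab (rd v) <> [::].
Proof.
move=> rE; have V0 := pos_INR nV; have i0 := pos_INR i; elim: i i0 => [|i IH] i0 tg.
  rewrite [INR 0]/= Rmult_0_l Rplus_0_r in tg *.
  exists (fun z => if z == root then [:: o] else [::]); split; last first.
    by move=> v; rewrite leqn0 => /eqP /lev_eq0 ->; rewrite rE eqxx.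
  split.
  - move=> z; case: eqP => // -> _; split; first exact: geodesic_nil.
    move=> v; rewrite rE [last _ _]/=; have := snap_close (boxP o); have := dist2_ge0 (pos v) (pt (rd o)); lra.
  - by move=> z P t w; case: eqP => _ /(congr1 size); rewrite /= !size_rcons.
  - by move=> z; case: ifP.
  - by move=> z; case: eqP => // -> _; apply: reached_root; rewrite eqxx.
have {}i0 := pos_INR i; rewrite S_INR in tg *.
have VE : 0 <= INR nV * (2 * err) by nra.
have [||lab [st low]] := IH; [by []|lra|].
have T0 := Rmult_le_pos _ _ i0 VE.
have [||lab' [st' ext' new']] := label_level (s := enum V) st low; rewrite -/nV; [lra|lra|].
exists lab'; split.
  by apply: strands_next; apply: strands_mono st'; rewrite -/nV; lra.
move=> v; rewrite leq_eqVlt => /orP[/eqP lv|lv]; first by apply: new'; rewrite ?mem_enum.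
by rewrite ext'; apply: low.
Qed.

Lemma label_spokes (s : seq node) tau lab : near_labels tau lab -> connected_labels lab ->
  (forall v, lab (rd v) <> [::]) -> (forall y, y \in s -> in_box (pt y)) -> 0 <= tau ->
  tau + INR (size s) * (2 * err) + 3 * err <= gap ->
  exists lab', [/\ near_labels (tau + INR (size s) * (2 * err)) lab', connected_labels lab', extends lab lab' &
     forall y, y \in s -> lab' y <> [::]].
Proof.
move=> nl cl lV; elim: s => [|y s IH] sb tau0 tg.
  by exists lab; split=> //; apply: near_labels_mono nl; rewrite /=; lra.
have sz0 := pos_INR (size s).
have sz : INR (size (y :: s)) = INR (size s) + 1 by rewrite -S_INR.
rewrite sz in tg *; have [|||lab1 [nl1 cl1 ext1 new1]] := IH; [|by []|nra|].
  by move=> z zs; apply: sb; rewrite inE zs orbT.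
have lq : lab1 (rd (nv y)) <> [::] by rewrite ext1.
have yb : in_box (pt y) by apply: sb; rewrite mem_head.
have [|lab2 [nl2 cl2 ext2 new2]] := label_spoke nl1 cl1 lq yb; first by nra.
exists lab2; split=> //; first by apply: near_labels_mono nl2; lra.
  exact: extends_trans ext2.
by move=> z; rewrite inE => /orP[/eqP -> //|zs]; rewrite ext2; exact: new1.
Qed.

Definition taxi (u v : node) := ((u.1 - v.1) + (v.1 - u.1) + (u.2 - v.2) + (v.2 - u.2))%N.

Lemma taxi_step u v t : taxi u v = t.+1 -> exists2 w, adjacent u w & taxi w v = t.
Proof.
case: u v => [i j] [k l]; rewrite /taxi /= => h.
have [ik|ki|ik] := ltngtP i k.
- have lt : (i.+1 < N.+1)%N by have := ltn_ord k; lia.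
  by exists (Ordinal lt, j); [exact: adjacent_h|rewrite /=; lia].
- have lt : (i.-1 < N.+1)%N by have := ltn_ord i; lia.
  by exists (Ordinal lt, j); [rewrite adjacent_sym; apply: adjacent_h => /=; lia|rewrite /=; lia].
have [jl|lj|jl] := ltngtP j l; last by lia.
- have lt : (j.+1 < N.+1)%N by have := ltn_ord l; lia.
  by exists (i, Ordinal lt); [exact: adjacent_v|rewrite /=; lia].
- have lt : (j.-1 < N.+1)%N by have := ltn_ord j; lia.
  by exists (i, Ordinal lt); [rewrite adjacent_sym; apply: adjacent_v => /=; lia|rewrite /=; lia].
Qed.

Lemma label_dilates t tau lab : near_labels tau lab -> connected_labels lab ->
  tau + INR t * (4 * eta) + 8 * eta <= gap ->
  exists lab', [/\ near_labels (tau + INR t * (4 * eta)) lab', connected_labels lab' &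
     forall u v, (taxi u v <= t)%N -> lab v <> [::] -> lab' u <> [::]].
Proof.
move=> nl cl; elim: t => [|t IH] tg.
  exists lab; split=> //; first by apply: near_labels_mono nl; rewrite /=; lra.
  move=> [i j] [k l]; rewrite leqn0 /taxi /= => /eqP h.
  by have -> : (i, j) = (k, l) by [congr (_, _); apply: val_inj => /=; lia].
have t0 := pos_INR t; rewrite S_INR in tg *; have [|lab1 [nl1 cl1 new1]] := IH; first by nra.
have [|lab2 [nl2 cl2 ext2 new2]] := label_dilate nl1 cl1; first by nra.
exists lab2; split=> //; first by apply: near_labels_mono nl2; lra.
move=> u v; rewrite leq_eqVlt => /orP[/eqP /taxi_step[w uw wv]|uv] lv.
  by apply: new2 uw _; apply: (new1 w v); rewrite ?wv.
by rewrite ext2; apply: (new1 u v).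
Qed.
End Labels.

(** * From labels on all nodes to a win *)

Section Win.
Variable lab : node -> seq V.
Variable tau : R.
Hypothesis nl : forall z, near tau (lab z) (pt z).
Hypothesis tg : tau + 8 * eta <= gap.

Definition wins u v := cops_beat (lab u) (lab v) (phi (lab u) (pt u) (lab v) (pt v)).

Lemma wins_sym u v : wins u v -> wins v u.
Proof. exact: cops_beat_phi_sym. Qed.

Lemma wins_trans u v w : dist2 (pt u) (pt v) <= 4 * eta -> dist2 (pt u) (pt w) <= 4 * eta ->
  wins u v -> wins v w -> wins u w.
Proof. by move=> uv uw; apply: (cops_beat_triangle (nl u) (nl v) (nl w) _ _ uw uv); lra. Qed.

(** A diagonal, of length at most [4 * eta], cuts the square into two triangles for [wins_trans]. *)
Lemma wins_square a b c d : adjacent a b -> adjacent b c -> adjacent a d ->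
  wins a b -> wins b c -> wins c d -> wins a d.
Proof.
move=> /adjacent_dist ab /adjacent_dist bc /adjacent_dist ad w1 w2 w3.
have ac := dist2_tri (pt a) (pt b) (pt c).
apply: (wins_trans _ _ (wins_trans _ _ w1 w2) w3); lra.
Qed.

(** Linked pairs are won because no uncaught vertex is inside their curve. They span the grid, and
    [grid_closure] extends the win to all edges. *)
Lemma wins_all (root : node) : (forall z, reached root lab z) -> forall u v, adjacent u v -> wins u v.
Proof.
move=> rch.
pose t u v := if ClassicalEpsilon.excluded_middle_informative (linked lab v u) then true else false.
have tP u v : t u v -> linked lab v u by rewrite /t; case: ClassicalEpsilon.excluded_middle_informative.
have ct v : connect t root v.
  elim: (rch v) => [_|x y _ IH l]; first exact: connect0.
  apply: connect_trans IH (connect1 _).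
  by rewrite /t; case: ClassicalEpsilon.excluded_middle_informative.
have tj u v : t u v -> exists d, joins d u v by move/tP => [/existsP[d jd] _ _ _]; exists d; rewrite /joins orbC.
have H := @grid_closure N t root ct tj (fun d => wins (end1 d) (end2 d)).
have {}H d : wins (end1 d) (end2 d).
  apply: H => [u v d' tuv jd|p d' ps Ed].
    have [_ _ _ tr] := tP _ _ tuv.
    have wvu : wins v u by exact: cops_beat_trivial.
    by case/orP: jd => /andP[/eqP -> /eqP ->] //; exact: wins_sym.
  pose bo : edge := inl (p.1, widen_ord (leqnSn N) p.2); pose tp : edge := inl (p.1, lift ord0 p.2).
  pose le : edge := inr (widen_ord (leqnSn N) p.1, p.2); pose ri : edge := inr (lift ord0 p.1, p.2).
  have cb : code bo \in square_sides p by rewrite !inE eqxx.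
  have ctp : code tp \in square_sides p by rewrite !inE eqxx orbT.
  have cl : code le \in square_sides p by rewrite !inE eqxx !orbT.
  have cr : code ri \in square_sides p by rewrite !inE eqxx !orbT.
  have adj d0 : adjacent (end1 d0) (end2 d0) by apply/existsP; exists d0; rewrite /joins !eqxx.
  have bt : bo != tp by apply/eqP => /(congr1 (@code N)) /= []; rewrite /bump /=; lia.
  have lr : le != ri by apply/eqP => /(congr1 (@code N)) /= []; rewrite /bump /=; lia.
  have : d' = bo \/ d' = tp \/ d' = le \/ d' = ri.
    by move: ps; rewrite !inE => /or4P[] /eqP ed; [left|right;left|right;right;left|right;right;right];
      apply: code_inj; rewrite ed.
  case=> [|[|[|]]] ed; subst d'.
  - apply: (@wins_square (end1 bo) (end2 le) (end2 tp) (end2 bo) (adj le) (adj tp) (adj bo)).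
    + exact: (Ed le cl isT).
    + by apply: (Ed tp ctp); rewrite eq_sym.
    + exact: wins_sym (Ed ri cr isT).
  - apply: (@wins_square (end1 tp) (end1 le) (end2 bo) (end2 tp) _ (adj bo) (adj tp)).
    + by rewrite adjacent_sym; exact: (adj le).
    + exact: wins_sym (Ed le cl isT).
    + exact: (Ed bo cb bt).
    + exact: (Ed ri cr isT).
  - apply: (@wins_square (end1 le) (end2 bo) (end2 tp) (end2 le) (adj bo) (adj ri) (adj le)).
    + exact: (Ed bo cb isT).
    + by apply: (Ed ri cr); rewrite eq_sym.
    + exact: wins_sym (Ed tp ctp isT).
  - apply: (@wins_square (end1 ri) (end1 le) (end2 le) (end2 ri) _ (adj le) (adj ri)).
    + by rewrite adjacent_sym; exact: (adj bo).
    + exact: wins_sym (Ed bo cb isT).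
    + exact: (Ed le cl lr).
    + exact: (Ed tp ctp isT).
by move=> u v /existsP[d /orP[] /andP[/eqP <- /eqP <-]] //; exact: wins_sym.
Qed.

Variable root : node.
Hypothesis rch : forall z, reached root lab z.

Definition trail (b : nat -> node) k := mkseq (fun j => pt (b j.+1)) k.

Lemma last_trail b k : last (pt (b 0%N)) (trail b k) = pt (b k).
Proof. by case: k => // k; rewrite /trail mkseqS last_rcons. Qed.

Lemma rays_trail x (g : nat -> bool) b k :
  (forall j, (j < k)%N -> ray x (pt (b j)) (pt (b j.+1)) = g j (+) g j.+1) ->
  rays x (pt (b 0%N) :: trail b k) = g 0%N (+) g k.
Proof.
elim: k => [|k IH] H; first by rewrite /= addbb.
have IH' := IH (fun j jk => H j (ltnW jk)).
have rS : rays x (pt (b 0%N) :: trail b k.+1) = rays x (pt (b 0%N) :: trail b k) (+) ray x (pt (b k)) (pt (b k.+1)).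
  rewrite /trail mkseqS; case: k {IH H IH'} => [|k]; first by rewrite /= addbF.
  by rewrite mkseqS -!rcons_cons rays_rcons.
by rewrite rS IH' (H k (ltnSn k)) -addbA addKb.
Qed.

Lemma wins_walk b k : (forall j, (j <= k)%N -> adjacent (b j) (b j.+1)) ->
  (forall j x x', (j <= k)%N -> step x x' -> ~ meets (pt (b j)) (pt (b j.+1)) (pos x) (pos x')) ->
  cops_beat (lab (b 0%N)) (lab (b k.+1)) (loop (lab (b 0%N)) (pt (b 0%N)) (lab (b k.+1)) (trail b k.+1)).
Proof.
elim: k => [|k IH] adj nm; first exact: (wins_all rch (adj 0%N (leqnn _))).
rewrite /trail mkseqS -/(trail b k.+1).
have nb j : near tau (lab (b j)) (pt (b j)) by exact: nl.
apply: (@cops_beat_extend tau _ _ (lab (b k.+1)) (trail b k.+1) _ _ (nb 0%N) _ (nb k.+2)).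
- by rewrite last_trail; exact: nb.
- by lra.
- move=> x x' xx' i; rewrite /trail -mkseqS size_mkseq => ik.
  have -> : nth (pt (b 0%N)) (pt (b 0%N) :: mkseq (fun j => pt (b j.+1)) k.+2) i = pt (b i).
    by case: i ik => [//|i] ik; rewrite /= nth_mkseq // ltnW.
  by rewrite nth_mkseq //; exact: nm.
- by apply: IH => [j jk|j x x' jk]; [apply: adj|apply: nm]; exact: leqW.
- by rewrite last_trail; exact: (wins_all rch (adj k.+1 (leqnn _))).
Qed.

Lemma meets_vertical a b x y c : a.1 = c -> b.1 = c ->
  (c < x.1 /\ c < y.1) \/ (x.1 < c /\ y.1 < c) -> ~ meets a b x y.
Proof.
move=> ac bc xy [s [t [s01 t01 /(congr1 fst)]]].
by case: a b x y ac bc xy => [a1 a2] [b1 b2] [x1 x2] [y1 y2] /= -> -> [] [h1 h2] h; case: (Rle_dec t (1 / 2)) => t2; nra.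
Qed.

Lemma meets_horizontal a b x y c : a.2 = c -> b.2 = c ->
  (c < x.2 /\ c < y.2) \/ (x.2 < c /\ y.2 < c) -> ~ meets a b x y.
Proof.
move=> ac bc xy [s [t [s01 t01 /(congr1 snd)]]].
by case: a b x y ac bc xy => [a1 a2] [b1 b2] [x1 x2] [y1 y2] /= -> -> [] [h1 h2] h; case: (Rle_dec t (1 / 2)) => t2; nra.
Qed.

Lemma ray_vertical x a b : a.1 = b.1 -> ray x a b = false.
Proof. by move=> ab; rewrite /ray ab addbb. Qed.

Lemma ray_below x a b c : a.2 = c -> b.2 = c -> c < x.2 -> ray x a b = false.
Proof.
move=> ac bc cx; rewrite /ray /orient ac bc; case: (RlebP a.1 x.1) => ha; case: (RlebP b.1 x.1) => hb //=.
all: by case: RltbP => // h; exfalso; nra.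
Qed.

Lemma ray_above x a b c : a.2 = c -> b.2 = c -> x.2 < c -> ray x a b = Rleb a.1 x.1 (+) Rleb b.1 x.1.
Proof.
move=> ac bc cx; rewrite /ray /orient ac bc; case: (RlebP a.1 x.1) => ha; case: (RlebP b.1 x.1) => hb //=.
all: by case: RltbP => // h; exfalso; nra.
Qed.

Hypothesis boxS : forall v, (A < (pos v).1 < A + INR N * eta) /\ (B < (pos v).2 < B + INR N * eta).
Hypothesis N0 : (0 < N)%N.

(** [top] and [bot] lead from the upper left to the upper right corner, and together they are the
    border of the grid, which winds an odd number of times around each vertex. The robber is thus
    inside exactly one of the two curves, as [cops_beat_start] requires. *)
Lemma cops_win_grid : cops_win e 9.
Proof.
pose top (j : nat) : node := (inord j, ord_max).
(* Down the left side, along the bottom, up the right side. *)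
pose bot (j : nat) : node := if (j <= N)%N then (ord0, inord (N - j)) else
  if (j <= N + N)%N then (inord (j - N), ord0) else (ord_max, inord (j - (N + N))).
have top0 : top 0%N = (ord0, ord_max) by congr (_, _); apply: val_inj; rewrite /= inordK.
have topN : top N = (ord_max, ord_max) by congr (_, _); apply: val_inj; rewrite /= inordK.
have bot0 : bot 0%N = (ord0, ord_max) by congr (_, _); apply: val_inj; rewrite /= inordK ?subn0.
have botN : bot (N + N + N)%N = (ord_max, ord_max).
  rewrite /bot !ifF; try lia; congr (_, _); apply: val_inj; rewrite /= inordK; lia.
have maxE : (ord_max : 'I_N.+1) = N :> nat by [].
have adj_top j : (j < N)%N -> adjacent (top j) (top j.+1).
  by move=> jN; apply: adjacent_h; rewrite !inordK //; lia.
have side_bot j : (j < N + N + N)%N -> adjacent (bot j) (bot j.+1) /\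
   [\/ (bot j).1 = ord0 /\ (bot j.+1).1 = ord0, (bot j).2 = ord0 /\ (bot j.+1).2 = ord0 |
       (bot j).1 = ord_max /\ (bot j.+1).1 = ord_max].
  move=> jN; rewrite /bot; case: (ltngtP j N) => [jl|lj|->].
  - split; last by constructor 1.
    by rewrite adjacent_sym; apply: adjacent_v; rewrite !inordK; lia.
  - case: (ltngtP j (N + N)%N) => [jl'|lj'|->].
    + split; last by constructor 2.
      by apply: adjacent_h; rewrite !inordK; lia.
    + split; last by constructor 3.
      by apply: adjacent_v; rewrite !inordK; lia.
    + have e1 : (inord (N + N - N) : 'I_N.+1) = ord_max.
        by apply: val_inj; rewrite /= inordK; lia.
      split; last by constructor 3; rewrite e1.
      by rewrite e1; apply: adjacent_v; rewrite inordK //=; lia.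
  - have l2 : (N < N + N)%N by lia.
    rewrite l2; have e1 : (inord (N - N) : 'I_N.+1) = ord0.
      by apply: val_inj; rewrite /= inordK; lia.
    split; last by constructor 2; rewrite e1.
    by rewrite e1; apply: adjacent_h; rewrite inordK //=; lia.
have ptN1 z : z.1 = ord_max -> (pt z).1 = A + INR N * eta by rewrite /pt /= => ->.
have ptN2 z : z.2 = ord_max -> (pt z).2 = B + INR N * eta by rewrite /pt /= => ->.
have pt01 z : z.1 = ord0 -> (pt z).1 = A by rewrite /pt /= => ->; rewrite [INR _]/=; ring.
have pt02 z : z.2 = ord0 -> (pt z).2 = B by rewrite /pt /= => ->; rewrite [INR _]/=; ring.
have Nk : N = N.-1.+1 by lia.
have W1 := @wins_walk top N.-1; rewrite -Nk in W1.
have {}W1 : cops_beat (lab (top 0%N)) (lab (top N)) (loop (lab (top 0%N)) (pt (top 0%N)) (lab (top N)) (trail top N)).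
  apply: W1 => [j jN|j x x' jN _]; first by apply: adj_top; lia.
  have [_ [_ x2]] := boxS x; have [_ [_ x2']] := boxS x'.
  by apply: (meets_horizontal (c := B + INR N * eta)); [exact: ptN2|exact: ptN2|right].
have Nk' : (N + N + N)%N = (N + N + N).-1.+1 by lia.
have W2 := @wins_walk bot (N + N + N).-1; rewrite -Nk' in W2.
have {}W2 : cops_beat (lab (bot 0%N)) (lab (bot (N + N + N)%N))
    (loop (lab (bot 0%N)) (pt (bot 0%N)) (lab (bot (N + N + N)%N)) (trail bot (N + N + N)%N)).
  have jlt j : (j <= (N + N + N).-1)%N -> (j < N + N + N)%N by lia.
  apply: W2 => [j /jlt /side_bot[] //|j x x' /jlt /side_bot[_ sd] _].
  have [[x1 x2] [x3 x4]] := boxS x; have [[x1' x2'] [x3' x4']] := boxS x'.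
  case: sd => -[s1 s2].
  - by apply: (meets_vertical (c := A)); [exact: pt01|exact: pt01|left].
  - by apply: (meets_horizontal (c := B)); [exact: pt02|exact: pt02|left].
  - by apply: (meets_vertical (c := A + INR N * eta)); [exact: ptN1|exact: ptN1|right].
rewrite bot0 botN -top0 -topN in W2; have [g0 gN] := (proj1 (nl (top 0%N)), proj1 (nl (top N))).
apply: (cops_beat_start sym_e g0 gN W1) => s1 s2 F x l1 l2 n12 on1 on2 lP lQ ph.
apply: (W2 s1 s2) => //; move: ph; have [[x1 x2] [x3 x4]] := boxS x.
rewrite /loop !last_trail.
have -> : last (pt (top 0%N)) (trail bot (N + N + N)) = pt (top N) by rewrite top0 -bot0 last_trail botN topN.
rewrite (@rays_trail _ (fun j => Rleb (pt (top j)).1 (pos x).1)); last first.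
  by move=> j jN; apply: (ray_above (c := B + INR N * eta)) => //; exact: ptN2.
have -> : rays (pos x) (pt (top 0%N) :: trail bot (N + N + N)) = false.
  rewrite top0 -bot0 (@rays_trail _ (fun=> false)) // => j /side_bot[_ sd] /=.
  case: sd => -[s1' s2'].
  - by apply: ray_vertical; rewrite !pt01.
  - by apply: (ray_below (c := B)) => //; exact: pt02.
  - by apply: ray_vertical; rewrite !ptN1.
have -> : Rleb (pt (top 0%N)).1 (pos x).1 = true by rewrite pt01 ?top0 //; apply/RlebP; lra.
have -> : Rleb (pt (top N)).1 (pos x).1 = false by rewrite ptN1 ?topN //; apply/RlebP; lra.
by rewrite /= addbT addbF negbK.
Qed.
End Win.
End Grid.

(** * Choice of the grid and of its mesh *)

Lemma coord_bound : exists2 M, 0 < M & forall v, - M < (pos v).1 < M /\ - M < (pos v).2 < M.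
Proof.
have ne : enum V <> [::] by move=> e0; have := mem_enum V o; rewrite e0.
have [m _ mP] := seq_min (fun v => - (Rabs (pos v).1 + Rabs (pos v).2)) ne.
exists (Rabs (pos m).1 + Rabs (pos m).2 + 1).
  by have := Rabs_pos (pos m).1; have := Rabs_pos (pos m).2; lra.
move=> v; have := mP v (mem_enum V v); move: (_ + Rabs (pos m).2) => K.
have := Rabs_pos (pos v).1; have := Rabs_pos (pos v).2.
by rewrite /Rabs; do 2!case: Rcase_abs; lra.
Qed.

Lemma nearest_exists (T : finType) (f : T -> R * R) :
  exists nv : T -> V, forall z v, dist2 (pos (nv z)) (f z) <= dist2 (pos v) (f z).
Proof.
have ne : enum V <> [::] by move=> e0; have := mem_enum V o; rewrite e0.
apply: (@fin_all_exists T (fun=> V) (fun z w => forall v, dist2 (pos w) (f z) <= dist2 (pos v) (f z))) => z.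
have [w _ wP] := seq_min (fun v => dist2 (pos v) (f z)) ne; exists w => v.
by apply: wP; rewrite mem_enum.
Qed.

Lemma archimedean a b : 0 <= a -> 0 < b -> exists2 n : nat, (0 < n)%N & a <= INR n * b.
Proof.
move=> a0 b0; have ab : 0 <= a / b by apply: Rmult_le_pos => //; exact: Rlt_le (Rinv_0_lt_compat _ b0).
have [_ h] := flrP ab; exists (flr (a / b)).+1 => //; rewrite S_INR.
have e1 : a / b * b = a by field; lra.
by nra.
Qed.

(* [n0] and [m] give a coarse subgrid, whose mesh does not depend on the mesh of the fine grid: errors add up
   along the [n0 * n0] walks from the coarse nodes, so that the fine mesh has to be chosen last. *)
Lemma nine_cops : cops_win e 9.
Proof.
have [M M0 MP] := coord_bound.
pose nV := size (enum V); pose L := (\max_v lev conn v)%N.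
have [n0 n00 n0P] := archimedean (a := 32 * M) (b := gap) ltac:(lra) gap0.
(* The loss of all walks in units of [16 * eta]: 1 at the root, 2 for each level and vertex, 2 for
   each coarse node, and a reserve of 6. *)
pose K := 1 + INR L * (INR nV * 2) + INR (n0 * n0) * 2 + 6.
have K0 : 0 < K.
  have := Rmult_le_pos _ _ (pos_INR L) (Rmult_le_pos _ 2 (pos_INR nV) ltac:(lra)).
  by have := pos_INR (n0 * n0); rewrite /K; lra.
have [m m0 mP] := archimedean (a := 64 * M * K) (b := gap) ltac:(nra) gap0.
have n0R : 1 <= INR n0 by apply: (le_INR 1); lia.
have mR : 1 <= INR m by apply: (le_INR 1); lia.
pose eta := 2 * M / (INR n0 * INR m).
have nm0 : 0 < INR n0 * INR m by nra.
have eta0 : 0 < eta by apply: Rmult_lt_0_compat; [lra|exact: Rinv_0_lt_compat].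
have etaE : eta * INR n0 * INR m = 2 * M by rewrite /eta; field; split; lra.
pose N := (n0 * m)%N; have N0 : (0 < N)%N by rewrite muln_gt0 n00.
have NE : INR N * eta = 2 * M by rewrite /N mult_INR -etaE; ring.
have boxS v : (- M < (pos v).1 < - M + INR N * eta) /\ (- M < (pos v).2 < - M + INR N * eta).
  by have := MP v; rewrite NE; lra.
have boxP v : in_box N (- M) (- M) eta (pos v) by have := boxS v; rewrite /in_box; lra.
pose gpt := pt (N := N) (- M) (- M) eta.
have [nv nvP] := nearest_exists gpt.
pose root := snap N (- M) (- M) eta (pos o).
have b1 : 16 * eta * K <= gap / 2.
  have : eta * INR m <= 2 * M by nra.
  have := Rmult_le_compat_r eta _ _ (Rlt_le _ _ eta0) mP; nra.
(* The walks take half of [gap], the dilations the other half. The loss of the latter depends only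
   on the coarse mesh [eta * INR m], which [n0] controls. *)
have b2 : INR (m + m) * (4 * eta) <= gap / 2.
  rewrite plus_INR; have : eta * INR m * (INR n0 * gap) = 2 * M * gap by rewrite -etaE; ring.
  have em : 0 < eta * INR m by nra.
  have := Rmult_le_compat_l (eta * INR m) _ _ (Rlt_le _ _ em) n0P; nra.
have LV : 0 <= INR L * (INR nV * (2 * (16 * eta))).
  apply: Rmult_le_pos (pos_INR _) _; apply: Rmult_le_pos (pos_INR _) _; lra.
have NN : 0 <= INR (n0 * n0) * (2 * (16 * eta)) by apply: Rmult_le_pos (pos_INR _) _; lra.
have total : 16 * eta + INR L * (INR nV * (2 * (16 * eta))) + INR (n0 * n0) * (2 * (16 * eta)) +
    6 * (16 * eta) <= gap / 2 by move: b1; rewrite /K; lra.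
have [|lab1 [[nl1 _ _ cl1] low1]] := label_levels eta0 nvP boxP (i := L) (erefl root).
  by rewrite -/nV; lra.
pose coarse := [seq (inord (a * m), inord (b * m)) : 'I_N.+1 * 'I_N.+1 | a <- iota 0 n0, b <- iota 0 n0].
have sc : size coarse = (n0 * n0)%N by rewrite size_allpairs !size_iota.
have lt_mul a : (a < n0)%N -> (a * m < N)%N by move=> an; rewrite ltn_pmul2r.
have cb y : y \in coarse -> in_box N (- M) (- M) eta (gpt y).
  case/allpairsP=> -[a b] [/=]; rewrite !mem_iota !add0n /= => an bn ->.
  have la := lt_mul _ an; have lb := lt_mul _ bn.
  have la' : INR (a * m) + 1 <= INR N by rewrite -S_INR; apply: le_INR; lia.
  have lb' : INR (b * m) + 1 <= INR N by rewrite -S_INR; apply: le_INR; lia.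
  rewrite /in_box /gpt /pt /= !inordK ?ltnS ?(ltnW la) ?(ltnW lb) //.
  by have := pos_INR (a * m); have := pos_INR (b * m); nra.
have [|||lab2 [nl2 cl2 _ new2]] := label_spokes eta0 nvP boxP nl1 cl1 _ cb.
- by move=> v; apply: low1; exact: leq_bigmax.
- by rewrite -/nV; lra.
- by rewrite sc -/nV; lra.
rewrite sc -/nV in nl2.
have [|lab3 [nl3 cl3 new3]] := label_dilates eta0 (t := (m + m)%N) nl2 cl2; first by lra.
have all_lab z : lab3 z <> [::].
  case: z => i j.
  (* Coarse indices stop at [n0.-1], since [in_box] excludes the upper and right borders; nodes
     there still have a coarse node within [m] in each coordinate. *)
  have near_mul (k : 'I_N.+1) : exists a, [/\ (a < n0)%N, (a * m <= k)%N & (k - a * m <= m)%N].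
    have k1 := leq_trunc_div k m; have k2 := ltn_ceil k m0; rewrite mulSn in k2.
    have kN : (k <= n0 * m)%N by rewrite -ltnS ltn_ord.
    case: (ltnP (k %/ m) n0.-1) => h.
      by exists (k %/ m); move: (k %/ m)%N (k %/ m * m)%N h k1 k2 => a am *; split; lia.
    have e1 : (m + n0.-1 * m = n0 * m)%N by rewrite -mulSn prednK.
    have e2 : (n0.-1 * m <= k %/ m * m)%N by rewrite leq_mul2r h orbT.
    exists n0.-1; move: (k %/ m * m)%N (n0.-1 * m)%N (n0 * m)%N e1 e2 k1 k2 kN => x y z *.
    by split; lia.
  have [a [an ai ia]] := near_mul i; have [b [bn bj jb]] := near_mul j.
  have la := lt_mul _ an; have lb := lt_mul _ bn.
  apply: (new3 (i, j) (inord (a * m), inord (b * m))).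
    by rewrite /taxi /= !inordK ?ltnS ?(ltnW la) ?(ltnW lb) //; lia.
  by apply: new2; apply/allpairsP; exists (a, b); rewrite !mem_iota !add0n.
apply: (cops_win_grid eta0 (fun z => nl3 z (all_lab z)) _ (fun z => cl3 z (all_lab z)) boxS N0).
lra.
Qed.
End Guard.

Section Gap.
Local Open Scope R_scope.
(** Half of the smallest excess over [r] among the finitely many values will do. *)
Lemma gap_exists (T : finType) (f : T -> R) (r : R) :
  exists2 gap : R, (0 < gap) & forall x, (f x <= r + gap) -> (f x <= r).
Proof.
have [e0|ne] := eqVneq [seq x <- enum T | ~~ Rleb (f x) r] [::].
  exists 1; first lra.
  move=> x _; apply/RlebP/negPn/negP => nx.
  have : x \in [seq x <- enum T | ~~ Rleb (f x) r] by rewrite mem_filter nx mem_enum.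
  by rewrite e0.
have [m] := seq_min f (elimN eqP ne); rewrite mem_filter => /andP[/RlebP nm _] mP.
exists ((f m - r) / 2); first lra.
move=> x fx; apply/RlebP/negPn/negP => nx.
have : (f m <= f x) by apply: mP; rewrite mem_filter nx mem_enum.
lra.
Qed.
End Gap.

Theorem theorem3 (n : nat) (x : 'I_n -> R * R) (r : R) :
  Rlt 0 r ->
  connected_graph (geom_adj x r) ->
  cop_number_le (geom_adj x r) 9.
Proof.
case: n x => [|n] x r0 conn.
  (* Without vertices the robber has no starting position. *)
  by exists 0; split=> //; exists id => -[].
exists 9; split=> //.
have [gap gap0 gapP] := gap_exists (fun uv : 'I_n.+1 * 'I_n.+1 => dist2 (x uv.1) (x uv.2)) r.
apply: (@nine_cops _ (geom_adj x r) x r gap ord0) => //.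
- by move=> u v; rewrite /geom_adj eq_sym dist2_sym.
- move=> u v; rewrite /Defs.step /geom_adj; case: eqVneq => [->|_] /=.
    by constructor; rewrite dist2_refl; lra.
  by case: Rle_dec => ?; constructor.
- by move=> u v; exact: (gapP (u, v)).
Qed.
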